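(* There exist universal constants $C, D$ (independent of everything, in particular of $E$) such that the following holds. Let $E \subset \mathbb{R}^2$ be a finite set. Then there exists a map $\mathcal{E} : C^2_+(E) \times [0,\infty) \to C^2_+(\mathbb{R}^2)$ such that: (A) For every $M \geq 0$ and every $f \in C^2_+(E)$ with $\|f\|_{C^2_+(E)} \leq M$, we have $\mathcal{E}(f,M) = f$ on $E$ and $\|\mathcal{E}(f,M)\|_{C^2(\mathbb{R}^2)} \leq CM$. (B) For each $x \in \mathbb{R}^2$ there exists a set $S(x) \subset E$ with $\#(S(x)) \leq D$ such that for all $M \geq 0$ and all $f, g \in C^2_+(E)$ with $\|f\|_{C^2_+(E)}, \|g\|_{C^2_+(E)} \leq M$ and $f|_{S(x)} = g|_{S(x)}$, we have $\partial^\alpha \mathcal{E}(f,M)(x) = \partial^\alpha \mathcal{E}(g,M)(x)$ for all multi-indices $|\alpha| \leq 2$.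
   Context: $C^2(\mathbb{R}^2)$ is the Banach space of twice continuously differentiable real functions $F$ on $\mathbb{R}^2$ with finite norm $\|F\|_{C^2(\mathbb{R}^2)} := \sup_{x \in \mathbb{R}^2}\big(\sum_{|\alpha| \leq 2}|\partial^\alpha F(x)|^2\big)^{1/2}$; $C^2_+(\mathbb{R}^2)$ denotes the set of $F \in C^2(\mathbb{R}^2)$ with $F \geq 0$. For a finite set $E \subset \mathbb{R}^2$, $C^2_+(E)$ is the set of all functions $f : E \to [0,\infty)$ (equivalently, restrictions to $E$ of elements of $C^2_+(\mathbb{R}^2)$), with trace norm $\|f\|_{C^2_+(E)} := \inf\{\|F\|_{C^2(\mathbb{R}^2)} : F \in C^2(\mathbb{R}^2),\ F|_E = f,\ F \geq 0 \text{ on } \mathbb{R}^2\}$. $\#(S)$ denotes the cardinality of a finite set $S$. The map $\mathcal{E}$ need not be linear. *)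

(* Defs.v *)
From Stdlib Require Import Reals List.
From Coquelicot Require Import Coquelicot.
Open Scope R_scope.

Definition dx (F : R * R -> R) : R * R -> R :=
  fun p => Derive (fun t => F (t, snd p)) (fst p).
Definition dy (F : R * R -> R) : R * R -> R :=
  fun p => Derive (fun t => F (fst p, t)) (snd p).

Definition partial (alpha : nat * nat) (F : R * R -> R) : R * R -> R :=
  Nat.iter (fst alpha) dx (Nat.iter (snd alpha) dy F).

Definition mindices2 : list (nat * nat) :=
  (0,0)%nat :: (1,0)%nat :: (0,1)%nat :: (2,0)%nat :: (1,1)%nat :: (0,2)%nat :: nil.

Definition ex_dx (F : R * R -> R) (p : R * R) : Prop :=
  ex_derive (fun t => F (t, snd p)) (fst p).
Definition ex_dy (F : R * R -> R) (p : R * R) : Prop :=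
  ex_derive (fun t => F (fst p, t)) (snd p).

Definition is_C2 (F : R * R -> R) : Prop :=
  (forall p, ex_dx F p /\ ex_dy F p /\
             ex_dx (dx F) p /\ ex_dy (dx F) p /\
             ex_dx (dy F) p /\ ex_dy (dy F) p) /\
  (forall alpha, In alpha mindices2 -> forall p : R * R,
      continuous (partial alpha F) p).

Definition jet_norm (F : R * R -> R) (x : R * R) : R :=
  sqrt (fold_right (fun alpha acc => (partial alpha F x)^2 + acc) 0 mindices2).

Definition C2_norm_le (F : R * R -> R) (B : R) : Prop :=
  forall x, jet_norm F x <= B.

Definition in_C2 (F : R * R -> R) : Prop :=
  is_C2 F /\ exists B, C2_norm_le F B.

Definition in_C2_plus (F : R * R -> R) : Prop :=
  in_C2 F /\ forall x, 0 <= F x.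

(* A function on the finite set E (given as a list of points) is represented
   by a total function f : R*R -> R, only its values on E being relevant.
   f in C^2_+(E): f >= 0 on E. *)
Definition in_C2_plus_E (E : list (R * R)) (f : R * R -> R) : Prop :=
  forall x, In x E -> 0 <= f x.

(* ||f||_{C^2_+(E)} <= M, where the trace norm is the infimum
   inf { ||F||_{C^2} : F in C^2(R^2), F = f on E, F >= 0 }
   (+infinity if no such F); inf <= M means: for every eps > 0 some
   admissible F has norm <= M + eps. *)
Definition trace_norm_le (E : list (R * R)) (f : R * R -> R) (M : R) : Prop :=
  forall eps, 0 < eps ->
    exists F, in_C2 F /\ (forall x, 0 <= F x) /\
              (forall x, In x E -> F x = f x) /\ C2_norm_le F (M + eps).

(* Main.v *)
Require Import Defs.
From Stdlib Require Import Reals List Lra Lia Psatz.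
From Stdlib Require Import ClassicalEpsilon FunctionalExtensionality PropExtensionality.
From Coquelicot Require Import Coquelicot.
Import ListNotations.
Open Scope R_scope.
Set Bullet Behavior "Strict Subproofs".

(* By Whitney's theorem it is enough to select a gradient v(x) at each x in E, depending on
   boundedly many values of f, such that the first order jets (f(x), v(x)) are compatible and
   |v(x)|^2 <= C M f(x); adding a multiple of M |y - x|^2 then makes every local piece nonnegative.

   Let F be an unknown interpolant of norm at most M.  Let s(x) be the smallest circumradius of a
   triangle of points of E near x (capped at 1).  Three values of f on that triangle determine
   grad F near x up to C M s(x), and a Lipschitz partition of unity at scale s turns these
   guesses into a field g with |g - grad F| <= C M s.  Where f < 4 M s^2, nonnegativity already
   gives |grad F| <= C M s, so g can be taken to be 0 there.  Below the scale s the set E lies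
   near a curve of curvature at most 1/s, so the direction u(x) from x to its nearest
   neighbour in E turns at rate at most 1/s; the derivative of F along u(x) is known up to
   M |u(x)|.  The field v = g + (projection of grad F - g on u) is then compatible at all scales. *)

(** * Plane geometry and nets *)

(** The list of points whose values may be read must be fixed before [f] is known. So scales, nets,
    triangles and neighbours are built from [E] alone, and [f] enters the selection only through its
    values on short lists; the one case distinction there reads a single value, at a net centre. It
    is forced by the sign condition: a gradient known up to [K * s] would violate [|v|^2 <= C K f]
    where [f] is much smaller than [K * s ^ 2].

    A local gradient is that of an arbitrary tame function with the prescribed values on such a
    list. Different choices are compared only through one global interpolant [F], which exists by
    the trace norm bound and does not enter the construction.

    Triangles fix the gradient up to [K * s], while compatibility at distance [D < s] asks for
    [K * D], and [K * D ^ 2] in Taylor's condition. Full accuracy is needed only along the curve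
    carrying [E]: across it the error varies slowly, and in Taylor's condition it is multiplied by
    the deviation [D / s] of a chord from the curve. *)

Definition pdist (x y : R * R) : R := Cmod (Cminus x y).
Definition dot (u w : R * R) : R := fst u * fst w + snd u * snd w.
Definition det (u w : R * R) : R := fst u * snd w - snd u * fst w.
(** The trailing factor makes this 0 at [u = 0], so a point without a neighbour receives no
    correction. *)
Definition proj (u w : R * R) : R * R := Cmult (RtoC (dot u w / dot u u)) u.

Ltac cring := apply injective_projections; simpl; ring.

Lemma pdist_refl x : pdist x x = 0.
Proof. unfold pdist. replace (x - x)%C with (RtoC 0) by cring. apply Cmod_0. Qed.

Lemma pdist_sym x y : pdist x y = pdist y x.
Proof. unfold pdist. rewrite <- Cmod_opp. f_equal. cring. Qed.

Lemma pdist_tri y x z : pdist x z <= pdist x y + pdist y z.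
Proof.
unfold pdist. replace (x - z)%C with ((x - y) + (y - z))%C by cring. apply Cmod_triangle.
Qed.

Lemma pdist_ge_0 x y : 0 <= pdist x y.
Proof. apply Cmod_ge_0. Qed.

Lemma pdist_gt_0 x y : x <> y -> 0 < pdist x y.
Proof.
intros H. apply Cmod_gt_0. intros H0. apply H.
replace x with ((x - y) + y)%C by cring. rewrite H0. cring.
Qed.

Lemma Cmod_sqr (u : R * R) : Cmod u ^ 2 = dot u u.
Proof. unfold Cmod, dot. rewrite pow2_sqrt; nra. Qed.

Lemma Cmod_le (u : R * R) (b : R) : 0 <= b -> dot u u <= b ^ 2 -> Cmod u <= b.
Proof.
intros Hb H. rewrite <- Cmod_sqr in H.
pose proof (Cmod_ge_0 u). nra.
Qed.

Lemma Cmod_le_abs (u : R * R) : Cmod u <= Rabs (fst u) + Rabs (snd u).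
Proof.
apply Cmod_le.
- pose proof (Rabs_pos (fst u)); pose proof (Rabs_pos (snd u)); lra.
- unfold dot. split_Rabs; nra.
Qed.

Lemma Rabs_fst_le (u : R * R) : Rabs (fst u) <= Cmod u.
Proof.
pose proof (Cmod_sqr u) as H. pose proof (Cmod_ge_0 u). unfold dot in H.
split_Rabs; nra.
Qed.

Lemma Rabs_snd_le (u : R * R) : Rabs (snd u) <= Cmod u.
Proof.
pose proof (Cmod_sqr u) as H. pose proof (Cmod_ge_0 u). unfold dot in H.
split_Rabs; nra.
Qed.

Lemma Rabs_sqr_le a b : 0 <= b -> a ^ 2 <= b ^ 2 -> Rabs a <= b.
Proof. intros. split_Rabs; nra. Qed.

Lemma dot_le u w : Rabs (dot u w) <= Cmod u * Cmod w.
Proof.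
apply Rabs_sqr_le.
- apply Rmult_le_pos; apply Cmod_ge_0.
- rewrite Rpow_mult_distr, !Cmod_sqr. unfold dot.
  pose proof (pow2_ge_0 (fst u * snd w - snd u * fst w)). nra.
Qed.

Lemma dot_Cminus_l u v w : dot (u - v)%C w = dot u w - dot v w.
Proof. unfold dot; simpl; ring. Qed.

Lemma dot_pos (u : R * R) : u <> (0, 0) -> 0 < dot u u.
Proof.
intros H. rewrite <- Cmod_sqr. apply pow_lt. apply Cmod_gt_0. exact H.
Qed.

Lemma proj_le u w : Cmod (proj u w) <= Cmod w.
Proof.
destruct (excluded_middle_informative (u = (0, 0))) as [->|Hu].
- replace (proj (0, 0) w) with (RtoC 0).
  + rewrite Cmod_0. apply Cmod_ge_0.
  + unfold proj. cring.
- pose proof (dot_pos u Hu) as Hp. apply Cmod_le. apply Cmod_ge_0.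
  rewrite Cmod_sqr.
  replace (dot (proj u w) (proj u w)) with (dot u w ^ 2 / dot u u).
  + apply (Rmult_le_reg_r (dot u u)); auto. unfold Rdiv.
    rewrite Rmult_assoc, Rinv_l, Rmult_1_r by lra.
    rewrite <- !Cmod_sqr, <- Rpow_mult_distr, Rmult_comm.
    pose proof (dot_le u w).
    apply pow_maj_Rabs. lra.
  + unfold proj, dot in *. simpl. field. lra.
Qed.

Lemma proj_Cminus u v w : proj u (v - w)%C = (proj u v - proj u w)%C.
Proof. apply injective_projections; unfold proj, dot, Rdiv; simpl; ring. Qed.

Lemma proj_dot_le u w c : 0 <= c -> Rabs (dot u w) <= c * Cmod u ^ 2 ->
  Cmod (proj u w) <= c * Cmod u.
Proof.
intros Hc H.
destruct (excluded_middle_informative (u = (0, 0))) as [->|Hu].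
- replace (proj (0, 0) w) with (RtoC 0).
  + rewrite Cmod_0. apply Rmult_le_pos; auto. apply Cmod_ge_0.
  + unfold proj. cring.
- pose proof (dot_pos u Hu) as Hp. unfold proj. rewrite Cmod_mult, Cmod_R.
  apply Rmult_le_compat_r. apply Cmod_ge_0.
  rewrite Rabs_div, (Rabs_right (dot u u)) by lra.
  apply Rle_div_l; auto. rewrite Cmod_sqr in H. exact H.
Qed.

(* Two rank one projections of the plane differ by the sine of the angle of their axes. *)
Lemma proj_diff u e w : u <> (0, 0) -> e <> (0, 0) ->
  Cmod (proj u w - proj e w)%C * (Cmod u * Cmod e) <= Rabs (det u e) * Cmod w.
Proof.
intros Hu He. pose proof (dot_pos u Hu) as Hu'. pose proof (dot_pos e He) as He'.
apply Rsqr_incr_0_var.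
2: apply Rmult_le_pos; [apply Rabs_pos|apply Cmod_ge_0].
rewrite !Rsqr_pow2, !Rpow_mult_distr, pow2_abs, !Cmod_sqr.
right. unfold proj, dot, det in *. simpl. field. split; lra.
Qed.

(** [w - proj u w] is the component of [w] normal to [u]; it pairs only with the normal part of [e],
    of length [|det u e| / |u|]. *)
Lemma proj_orth u w e : u <> (0, 0) ->
  Rabs (dot (w - proj u w)%C e) * Cmod u <= Cmod w * Rabs (det u e).
Proof.
intros Hu. pose proof (dot_pos u Hu) as Hu'.
apply (Rmult_le_reg_r (Cmod u)). now apply Cmod_gt_0.
replace (Rabs (dot (w - proj u w)%C e) * Cmod u * Cmod u)
  with (Rabs (dot (w - proj u w)%C e * dot u u)).
2:{ rewrite Rabs_mult, (Rabs_right (dot u u)), <- Cmod_sqr by lra. ring. }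
replace (dot (w - proj u w)%C e * dot u u) with (det u w * det u e)
  by (unfold proj, dot, det in *; simpl; field; lra).
rewrite Rabs_mult.
replace (Cmod w * Rabs (det u e) * Cmod u) with ((Cmod w * Cmod u) * Rabs (det u e)) by ring.
apply Rmult_le_compat_r. apply Rabs_pos.
apply Rabs_sqr_le. apply Rmult_le_pos; apply Cmod_ge_0.
rewrite Rpow_mult_distr, !Cmod_sqr. unfold dot, det.
pose proof (pow2_ge_0 (fst u * fst w + snd u * snd w)). nra.
Qed.

(** Cramer's rule without division: [det u v * w] is [(w.u) v - (w.v) u] with [u] and [v] turned by
    a quarter. *)
Lemma det_solve u v w : Cmod w * Rabs (det u v)
  <= Rabs (dot w u) * Cmod v + Rabs (dot w v) * Cmod u.
Proof.
rewrite <- (Cmod_R (det u v)), <- Cmod_mult.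
replace (w * det u v)%C with
  (dot w u * (snd v, (- fst v)%R) + - (dot w v * (snd u, (- fst u)%R)))%C.
2:{ apply injective_projections; unfold dot, det; simpl; ring. }
eapply Rle_trans. apply Cmod_triangle.
rewrite Cmod_opp, !Cmod_mult, !Cmod_R. unfold Cmod; simpl.
right. f_equal; f_equal; f_equal; ring.
Qed.

Lemma Cmod_convex a b t r : 0 <= t <= 1 -> Cmod a <= r -> Cmod b <= r ->
  Cmod (a + t * (b - a))%C <= r.
Proof.
intros Ht Ha Hb. replace (a + t * (b - a))%C with (RtoC (1 - t) * a + t * b)%C.
2:{ apply injective_projections; simpl; ring. }
eapply Rle_trans. apply Cmod_triangle.
rewrite !Cmod_mult, !Cmod_R, !Rabs_right by lra. nra.
Qed.

(** * Lipschitz scales, packing and nets *)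

Definition lip1 (s : R * R -> R) : Prop := forall x y, s x <= s y + pdist x y.

Lemma lip1_pdist a : lip1 (fun x => pdist x a).
Proof. intros x y. pose proof (pdist_tri y x a). lra. Qed.

Lemma lip1_const c : lip1 (fun _ => c).
Proof. intros x y. pose proof (pdist_ge_0 x y). lra. Qed.

Lemma lip1_max s t : lip1 s -> lip1 t -> lip1 (fun x => Rmax (s x) (t x)).
Proof.
intros Hs Ht x y. specialize (Hs x y). specialize (Ht x y).
unfold Rmax; repeat destruct Rle_dec; lra.
Qed.

(** A minimum of 1 and finitely many functions. Finiteness preserves a uniform positive lower bound
    and makes the minimum attained; the last clause names the configuration in [E] that later
    supplies information at [x]. *)
Lemma scale_exists {I : Type} (L : list I) (h : I -> R * R -> R) :
  (forall i, In i L -> lip1 (h i)) ->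
  (forall i, In i L -> exists m, 0 < m /\ forall x, m <= h i x) ->
  exists s, lip1 s /\ (exists m, 0 < m /\ forall x, m <= s x) /\ (forall x, s x <= 1) /\
    (forall x i, In i L -> s x <= h i x) /\
    (forall x, s x = 1 \/ exists i, In i L /\ h i x = s x).
Proof.
intros Hl Hm. induction L as [|i L IH].
- exists (fun _ => 1). split; [apply lip1_const|]. split; [exists 1; split; [lra|intros; lra]|].
  split; [intros; lra|]. split; [intros x i []|]. auto.
- destruct IH as (s & H1 & (m & Hm0 & H2) & H3 & H4 & H5).
  { intros; apply Hl; now right. } { intros; apply Hm; now right. }
  destruct (Hm i (or_introl eq_refl)) as (m' & Hm' & Hi).
  exists (fun x => Rmin (h i x) (s x)). split; [|split; [|split; [|split]]].
  + intros x y. pose proof (H1 x y). pose proof (Hl i (or_introl eq_refl) x y).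
    unfold Rmin; repeat destruct Rle_dec; lra.
  + exists (Rmin m m'). split. apply Rmin_glb_lt; auto.
    intros x. specialize (H2 x). specialize (Hi x).
    unfold Rmin; repeat destruct Rle_dec; lra.
  + intros x. specialize (H3 x). pose proof (Rmin_r (h i x) (s x)). lra.
  + intros x j [<-|Hj]. apply Rmin_l. eapply Rle_trans. apply Rmin_r. auto.
  + intros x. unfold Rmin. destruct Rle_dec as [Hle|Hle].
    * right. exists i. split; auto. now left.
    * destruct (H5 x) as [E|(j & Hj & E)]. now left. right. exists j. split; auto. now right.
Qed.

Lemma choice_fun {A B : Type} (P : A -> B -> Prop) :
  (forall a, exists b, P a b) -> exists f, forall a, P a (f a).
Proof.
intros H. exists (fun a => proj1_sig (constructive_indefinite_description _ (H a))).
intros a. apply proj2_sig.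
Qed.

(** Pigeonhole on a square grid of side [s]: points of one cell differ by at most [s] in each
    coordinate, so they are within [2 * s] and must coincide. *)
Lemma packing (K : nat) (s : R) (y : R * R) (Z : list (R * R)) :
  0 < s -> NoDup Z -> (forall z, In z Z -> pdist z y <= INR K * s) ->
  (forall z z', In z Z -> In z' Z -> z <> z' -> 2 * s < pdist z z') ->
  (length Z <= (2 * K + 1) * (2 * K + 1))%nat.
Proof.
intros Hs Hnd HR Hsep.
assert (Hcell : forall x : R, exists n : nat, 0 <= x -> INR n <= x < INR n + 1).
{ intros x. destruct (Rle_dec 0 x) as [Hx|Hx].
  - destruct (nfloor_ex x Hx) as [n Hn]. exists n. auto.
  - exists 0%nat. intros; lra. }
destruct (choice_fun _ Hcell) as [fl Hfl].
set (cell := fun z : R * R => (fl ((fst z - fst y) / s + INR K), fl ((snd z - snd y) / s + INR K))).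
assert (Hb : forall z, In z Z -> Rabs (fst z - fst y) <= INR K * s /\ Rabs (snd z - snd y) <= INR K * s).
{ intros z Hz. specialize (HR z Hz). unfold pdist in HR.
  pose proof (Rabs_fst_le (z - y)%C). pose proof (Rabs_snd_le (z - y)%C). simpl in *.
  unfold Rminus. split; lra. }
assert (Hr : forall t, Rabs t <= INR K * s -> 0 <= t / s + INR K <= 2 * INR K).
{ intros t Ht. apply Rabs_le_between in Ht.
  assert (Ht' : t = t / s * s) by (field; lra).
  split; apply (Rmult_le_reg_r s); auto; rewrite Rmult_plus_distr_r, <- Ht'; lra. }
assert (Hc : forall z z', In z Z -> In z' Z -> cell z = cell z' -> z = z').
{ intros z z' Hz Hz' E. destruct (excluded_middle_informative (z = z')) as [|n]; auto.
  specialize (Hsep z z' Hz Hz' n). exfalso.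
  destruct (Hb z Hz) as [A1 A2]. destruct (Hb z' Hz') as [B1 B2].
  unfold cell in E. injection E as E1 E2.
  assert (HH : forall t t' : R, Rabs t <= INR K * s -> Rabs t' <= INR K * s ->
     fl (t / s + INR K) = fl (t' / s + INR K) -> Rabs (t - t') <= s).
  { intros t t' T T' E. pose proof (Hfl _ (proj1 (Hr t T))) as F1.
    pose proof (Hfl _ (proj1 (Hr t' T'))) as F2. rewrite E in F1.
    replace (t - t') with ((t / s - t' / s) * s) by (field; lra).
    rewrite Rabs_mult, (Rabs_right s) by lra. apply Rle_trans with (1 * s). 2: lra.
    apply Rmult_le_compat_r. lra.
    apply Rabs_le_between. lra. }
  pose proof (HH _ _ A1 B1 E1). pose proof (HH _ _ A2 B2 E2).
  pose proof (Cmod_le_abs (z - z')%C). unfold pdist in Hsep. simpl in *.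
  replace (fst z + - fst z') with (fst z - fst y - (fst z' - fst y)) in * by ring.
  replace (snd z + - snd z') with (snd z - snd y - (snd z' - snd y)) in * by ring.
  lra. }
set (G := list_prod (seq 0 (2 * K + 1)) (seq 0 (2 * K + 1))).
replace ((2 * K + 1) * (2 * K + 1))%nat with (length G)
  by (unfold G; rewrite length_prod, !length_seq; reflexivity).
rewrite <- (length_map cell). apply NoDup_incl_length.
- apply NoDup_map_NoDup_ForallPairs; [|exact Hnd]. intros z z' Hz Hz' E. exact (Hc z z' Hz Hz' E).
- intros c Hin. apply in_map_iff in Hin. destruct Hin as (z & <- & Hz).
  destruct (Hb z Hz) as [A1 A2].
  assert (HN : forall t : R, Rabs t <= INR K * s -> In (fl (t / s + INR K)) (seq 0 (2 * K + 1))).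
  { intros t T. destruct (Hr t T) as [R1 R2]. pose proof (Hfl _ R1) as F1.
    apply in_seq. split. lia.
    assert (INR (fl (t / s + INR K)) < INR (2 * K + 1)).
    { rewrite plus_INR, mult_INR. simpl. lra. }
    apply INR_lt in H. lia. }
  apply in_prod; apply HN; auto.
Qed.

(** The radius is a fixed fraction of the scale at [z], so [s y] and [s z] are comparable whenever
    [z] acts at [y]. All cutoffs below are supported in this ball. *)
Definition active (s : R * R -> R) (y z : R * R) : bool :=
  if Rle_dec (pdist y z) (s z / 4) then true else false.

Lemma activeP s y z : active s y z = true <-> pdist y z <= s z / 4.
Proof. unfold active. destruct Rle_dec; split; intros; auto; discriminate. Qed.

Lemma active_scale s y z : lip1 s -> pdist y z <= s z / 4 -> s y <= 5 / 4 * s z /\ 3 / 4 * s z <= s y.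
Proof.
intros Hs H. pose proof (Hs y z). pose proof (Hs z y). rewrite (pdist_sym z y) in *. lra.
Qed.

(** Greedy selection: [p] is added only if it is farther than [s z / 32] from each earlier centre
    [z]. Then [s p <= s z + pdist p z < 33 * pdist p z], so the separation holds with the scale at
    either centre. *)
Lemma net_exists (s : R * R -> R) (L : list (R * R)) :
  lip1 s -> (forall x, 0 < s x) -> exists Z, incl Z L /\ NoDup Z /\
    (forall p, In p L -> exists z, In z Z /\ pdist p z <= s z / 32) /\
    (forall z z', In z Z -> In z' Z -> z <> z' -> s z <= 33 * pdist z z').
Proof.
intros Hs Hpos. induction L as [|p L (Z & H1 & H2 & H3 & H4)].
- exists nil. split; [apply incl_nil_l|]. split; [constructor|]. split; [intros ? []|intros ? ? []].

- destruct (excluded_middle_informative (exists z, In z Z /\ pdist p z <= s z / 32)) as [Hp|Hp].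
  + exists Z. split; [now apply incl_tl|]. split; [auto|]. split; [|auto].
    intros q [<-|Hq]; auto.
  + assert (Hfar : forall z, In z Z -> s z / 32 < pdist p z).
    { intros z Hz. apply Rnot_le_lt. intros Hle. apply Hp. eauto. }
    exists (p :: Z). split; [|split; [|split]].
    * apply incl_cons. now left. now apply incl_tl.
    * constructor; [|exact H2]. intros Hin. specialize (Hfar p Hin). rewrite pdist_refl in Hfar.
      specialize (Hpos p). lra.
    * intros q [<-|Hq].
      -- exists p. rewrite pdist_refl. specialize (Hpos p). split. now left. lra.
      -- destruct (H3 q Hq) as (z & Hz & Hd). exists z. split; auto. now right.
    * intros z z' [<-|Hz] [<-|Hz'] Hne; auto.
      -- congruence.
      -- specialize (Hfar z' Hz'). pose proof (Hs p z'). lra.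
      -- specialize (Hfar z Hz). rewrite pdist_sym. pose proof (pdist_ge_0 p z). lra.
Qed.

Lemma net_bounded_overlap : exists N, forall (s : R * R -> R) (Z : list (R * R)), lip1 s -> (forall x, 0 < s x) ->
  NoDup Z -> (forall z z', In z Z -> In z' Z -> z <> z' -> s z <= 33 * pdist z z') ->
  forall y, (length (filter (active s y) Z) <= N)%nat.
Proof.
eexists. intros s Z Hs Hpos Hnd Hsep y.
assert (HA : forall z, In z (filter (active s y) Z) -> In z Z /\ pdist y z <= s z / 4).
{ intros z Hz. apply filter_In in Hz. now rewrite activeP in Hz. }
(* Active centres lie within [s y / 3] of [y] and are more than [s y / 45] apart: these are [30 * r]
   and [2 * r] for [r = s y / 90]. *)
apply (packing 30 (s y / 90) y).
- specialize (Hpos y); lra.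
- now apply NoDup_filter.
- intros z Hz. destruct (HA z Hz) as [_ H]. destruct (active_scale s y z Hs H).
  rewrite pdist_sym. simpl. lra.
- intros z z' Hz Hz' Hne. destruct (HA z Hz) as [Iz H]. destruct (HA z' Hz') as [Iz' _].
  destruct (active_scale s y z Hs H). specialize (Hsep z z' Iz Iz' Hne).
  specialize (Hpos y). lra.
Qed.

(** * Interpolants with controlled gradient *)

(** The first order consequences of a C^2 bound on which the selection rests; local choices range
    over such pairs. The bound on [V] is nonnegativity in quantitative form, the discriminant
    condition for a quadratic majorant that stays nonnegative. *)
Definition tame (K : R) (F : R * R -> R) (V : R * R -> R * R) : Prop :=
  (forall x, 0 <= F x <= K /\ Cmod (V x) ^ 2 <= 4 * K * F x) /\
  (forall x y, Cmod (V x - V y)%C <= K * pdist x y) /\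
  (forall x y, Rabs (F y - F x - dot (V x) (y - x)%C) <= K * pdist x y ^ 2).

Lemma partial_le F B alpha p : C2_norm_le F B -> In alpha mindices2 -> Rabs (partial alpha F p) <= B.
Proof.
intros H Ha. eapply Rle_trans; [|apply (H p)]. unfold jet_norm.
rewrite <- (sqrt_pow2 (Rabs (partial alpha F p))) by apply Rabs_pos.
apply sqrt_le_1_alt. rewrite pow2_abs.
assert (Hpos : forall l, 0 <= fold_right (fun a acc => (partial a F p)^2 + acc) 0 l).
{ induction l as [|a l IH]; cbn [fold_right]. lra. pose proof (pow2_ge_0 (partial a F p)). lra. }
revert Ha. generalize mindices2. induction l as [|a l IH]; intros []; cbn [fold_right].
- subst. pose proof (Hpos l). lra.
- pose proof (pow2_ge_0 (partial a F p)). specialize (IH H0). lra.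
Qed.

Lemma mvt_derive (f : R -> R) a b : (forall t, ex_derive f t) ->
  exists c, Rabs (c - a) <= Rabs (b - a) /\ f b - f a = Derive f c * (b - a).
Proof.
intros Hd. destruct (MVT_gen f a b (Derive f)) as (c & Hc & E).
- intros x _. now apply Derive_correct.
- intros x _. apply continuity_pt_filterlim. apply (ex_derive_continuous (V := R_NormedModule)). apply Hd.
- exists c. split; auto. unfold Rmin, Rmax in Hc. destruct Rle_dec; split_Rabs; lra.
Qed.

Lemma mvt_le (f : R -> R) B a b : (forall t, ex_derive f t) -> (forall t, Rabs (Derive f t) <= B) ->
  Rabs (f b - f a) <= B * Rabs (b - a).
Proof.
intros Hd HB. destruct (mvt_derive f a b Hd) as (c & _ & ->).
rewrite Rabs_mult. apply Rmult_le_compat_r; auto. apply Rabs_pos.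
Qed.

Lemma Derive_le_of_lipschitz (f : R -> R) L x : ex_derive f x ->
  (forall t, Rabs (f t - f x) <= L * Rabs (t - x)) -> Rabs (Derive f x) <= L.
Proof.
intros Hd HL. apply Rnot_lt_le. intros Hlt.
apply Derive_correct in Hd. apply is_derive_Reals in Hd.
destruct (Hd ((Rabs (Derive f x) - L) / 2) ltac:(lra)) as [del Hdel].
pose proof (cond_pos del) as Hp.
specialize (Hdel (del / 2) ltac:(lra) ltac:(rewrite Rabs_right; lra)).
specialize (HL (x + del / 2)). replace (x + del / 2 - x) with (del / 2) in HL by ring.
assert (HQ : Rabs ((f (x + del / 2) - f x) / (del / 2)) <= L).
{ rewrite Rabs_div by lra. apply Rle_div_l. apply Rabs_pos_lt; lra. exact HL. }
revert HQ Hdel Hlt. generalize ((f (x + del / 2) - f x) / (del / 2)). intros q. split_Rabs; lra.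
Qed.

Lemma dx_lipschitz_x F B p q b : is_C2 F -> C2_norm_le F B ->
  Rabs (dx F (q, b) - dx F (p, b)) <= B * Rabs (q - p).
Proof.
intros [HF _] HB. apply (mvt_le (fun t => dx F (t, b))).
- intros t. apply (HF (t, b)).
- intros t. apply (partial_le F B (2, 0)%nat (t, b) HB). simpl; tauto.
Qed.

Lemma dy_lipschitz_x F B p q b : is_C2 F -> C2_norm_le F B ->
  Rabs (dy F (q, b) - dy F (p, b)) <= B * Rabs (q - p).
Proof.
intros [HF _] HB. apply (mvt_le (fun t => dy F (t, b))).
- intros t. apply (HF (t, b)).
- intros t. apply (partial_le F B (1, 1)%nat (t, b) HB). simpl; tauto.
Qed.

Lemma dy_lipschitz_y F B p q a : is_C2 F -> C2_norm_le F B ->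
  Rabs (dy F (a, q) - dy F (a, p)) <= B * Rabs (q - p).
Proof.
intros [HF _] HB. apply (mvt_le (fun t => dy F (a, t))).
- intros t. apply (HF (a, t)).
- intros t. apply (partial_le F B (0, 2)%nat (a, t) HB). simpl; tauto.
Qed.

(* The norm only controls the mixed derivative in the order dx (dy F); the Lipschitz bound
   of dx F in the second variable is read off the second mixed difference of F. *)
Lemma dx_lipschitz_y F B p q a : is_C2 F -> C2_norm_le F B ->
  Rabs (dx F (a, q) - dx F (a, p)) <= B * Rabs (q - p).
Proof.
intros HC HB. pose proof (proj1 HC) as HF.
assert (Hx : forall s t, ex_derive (fun u => F (u, s)) t) by (intros s t; apply (HF (t, s))).
assert (Hy : forall s t, ex_derive (fun u => F (s, u)) t) by (intros s t; apply (HF (s, t))).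
unfold dx; simpl. rewrite <- Derive_minus by auto.
apply Derive_le_of_lipschitz.
{ apply (ex_derive_minus (V := R_NormedModule)); auto. }
intros t.
replace (F (t, q) - F (t, p) - (F (a, q) - F (a, p)))
  with ((fun u => F (t, u) - F (a, u)) q - (fun u => F (t, u) - F (a, u)) p) by ring.
replace (B * Rabs (q - p) * Rabs (t - a)) with (B * Rabs (t - a) * Rabs (q - p)) by ring.
apply (mvt_le (fun u => F (t, u) - F (a, u))).
- intros u. apply (ex_derive_minus (V := R_NormedModule)); auto.
- intros u. rewrite Derive_minus by auto. apply (dy_lipschitz_x F B a t u HC HB).
Qed.

(** Taylor's bound comes from the mean value theorem along a path from [x] to [y] parallel to the
    second axis and then to the first, with the Lipschitz bounds moving the derivatives back to
    [x]. *)
Lemma tame_of_C2 F B : 0 < B -> is_C2 F -> (forall x, 0 <= F x) -> C2_norm_le F B ->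
  exists V, tame (8 * B) F V.
Proof.
intros HB HC Hpos HN. exists (fun x => (dx F x, dy F x)).
assert (HT : forall x y, Rabs (F y - F x - dot (dx F x, dy F x) (y - x)%C) <= 8 * B * pdist x y ^ 2).
{ intros [x1 x2] [y1 y2].
  assert (H1 : Rabs (y1 - x1) <= pdist (x1, x2) (y1, y2)).
  { rewrite pdist_sym. exact (Rabs_fst_le ((y1, y2) - (x1, x2))%C). }
  assert (H2 : Rabs (y2 - x2) <= pdist (x1, x2) (y1, y2)).
  { rewrite pdist_sym. exact (Rabs_snd_le ((y1, y2) - (x1, x2))%C). }
  set (d := pdist _ _) in *.
  destruct (mvt_derive (fun t => F (t, y2)) x1 y1) as (c & Hc & E1).
  { intros t. apply (proj1 HC (t, y2)). }
  destruct (mvt_derive (fun t => F (x1, t)) x2 y2) as (c' & Hc' & E2).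
  { intros t. apply (proj1 HC (x1, t)). }
  change (Derive (fun t => F (t, y2)) c) with (dx F (c, y2)) in E1.
  change (Derive (fun t => F (x1, t)) c') with (dy F (x1, c')) in E2.
  pose proof (dx_lipschitz_x F B x1 c y2 HC HN) as L1.
  pose proof (dx_lipschitz_y F B x2 y2 x1 HC HN) as L2.
  pose proof (dy_lipschitz_y F B x2 c' x1 HC HN) as L3.
  replace (F (y1, y2) - F (x1, x2) - dot (dx F (x1, x2), dy F (x1, x2)) ((y1, y2) - (x1, x2))%C)
    with ((dx F (c, y2) - dx F (x1, y2)) * (y1 - x1) + (dx F (x1, y2) - dx F (x1, x2)) * (y1 - x1)
          + (dy F (x1, c') - dy F (x1, x2)) * (y2 - x2)).
  2:{ unfold dot; simpl. lra. }
  assert (HM : forall u v, Rabs u <= B * d -> Rabs v <= d -> Rabs (u * v) <= B * d * d).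
  { intros u v Hu Hv. rewrite Rabs_mult. apply Rmult_le_compat; auto; apply Rabs_pos. }
  assert (Hd : forall u v w, Rabs u <= B * Rabs v -> Rabs v <= Rabs w -> Rabs w <= d -> Rabs u <= B * d).
  { intros u v w Hu Hv Hw. eapply Rle_trans; [exact Hu|]. apply Rmult_le_compat_l; lra. }
  eapply Rle_trans; [apply Rabs_triang|]. eapply Rle_trans.
  { apply Rplus_le_compat; [apply Rabs_triang|apply Rle_refl]. }
  pose proof (HM _ _ (Hd _ _ _ L1 Hc H1) H1). pose proof (HM _ _ (Hd _ _ _ L2 (Rle_refl _) H2) H1).
  pose proof (HM _ _ (Hd _ _ _ L3 Hc' H2) H2). assert (0 <= B * d * d) by (pose proof (Rabs_pos (y1 - x1)); apply Rmult_le_pos; nra).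
  nra. }
split; [|split]; auto.
- intros x. split.
  + split; auto. pose proof (partial_le F B (0, 0)%nat x HN ltac:(simpl; tauto)) as H.
    change (partial (0, 0)%nat F x) with (F x) in H. pose proof (Rle_abs (F x)). lra.
  + set (v := (dx F x, dy F x)) in *.
    (* The step against the gradient that minimises the Taylor majorant; nonnegativity at its end
       gives [|v|^2 <= 32 * B * F x]. *)
    specialize (HT x (x - RtoC (/ (16 * B)) * v)%C). fold v in HT.
    replace (x - RtoC (/ (16 * B)) * v - x)%C with (- (RtoC (/ (16 * B)) * v))%C in HT by cring.
    unfold pdist in HT.
    replace (x - (x - RtoC (/ (16 * B)) * v))%C with (RtoC (/ (16 * B)) * v)%C in HT by cring.
    pose proof (Hpos (x - RtoC (/ (16 * B)) * v)%C) as Hp.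
    rewrite Cmod_mult, Cmod_R, Rpow_mult_distr, pow2_abs in HT.
    assert (Hd : dot v (- (RtoC (/ (16 * B)) * v))%C = - / (16 * B) * Cmod v ^ 2).
    { rewrite Cmod_sqr. unfold dot; simpl; ring. }
    rewrite Hd in HT. apply Rabs_le_between in HT. destruct HT as [_ HT].
    apply (Rmult_le_reg_r (/ (32 * B))). { apply Rinv_0_lt_compat; lra. }
    replace (4 * (8 * B) * F x * / (32 * B)) with (F x) by (field; lra).
    replace (8 * B * ((/ (16 * B)) ^ 2 * Cmod v ^ 2)) with (Cmod v ^ 2 * / (32 * B)) in HT by (field; lra).
    replace (- / (16 * B) * Cmod v ^ 2) with (- 2 * (Cmod v ^ 2 * / (32 * B))) in HT by (field; lra).
    lra.
- intros [x1 x2] [y1 y2].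
  assert (H1 : Rabs (x1 - y1) <= pdist (x1, x2) (y1, y2)).
  { exact (Rabs_fst_le ((x1, x2) - (y1, y2))%C). }
  assert (H2 : Rabs (x2 - y2) <= pdist (x1, x2) (y1, y2)).
  { exact (Rabs_snd_le ((x1, x2) - (y1, y2))%C). }
  set (d := pdist _ _) in *.
  eapply Rle_trans; [apply Cmod_le_abs|]. simpl.
  pose proof (dx_lipschitz_x F B y1 x1 x2 HC HN) as L1.
  pose proof (dx_lipschitz_y F B y2 x2 y1 HC HN) as L2.
  pose proof (dy_lipschitz_x F B y1 x1 x2 HC HN) as L3.
  pose proof (dy_lipschitz_y F B y2 x2 y1 HC HN) as L4.
  assert (P1 : B * Rabs (x1 - y1) <= B * d) by (apply Rmult_le_compat_l; lra).
  assert (P2 : B * Rabs (x2 - y2) <= B * d) by (apply Rmult_le_compat_l; lra).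
  pose proof (Rmult_le_pos B _ (Rlt_le _ _ HB) (Rabs_pos (x1 - y1))).
  assert (HX : Rabs (dx F (x1, x2) + - dx F (y1, y2)) <= 4 * B * d).
  { replace (dx F (x1, x2) + - dx F (y1, y2))
      with ((dx F (x1, x2) - dx F (y1, x2)) + (dx F (y1, x2) - dx F (y1, y2))) by ring.
    eapply Rle_trans; [apply Rabs_triang|]. lra. }
  assert (HY : Rabs (dy F (x1, x2) + - dy F (y1, y2)) <= 4 * B * d).
  { replace (dy F (x1, x2) + - dy F (y1, y2))
      with ((dy F (x1, x2) - dy F (y1, x2)) + (dy F (y1, x2) - dy F (y1, y2))) by ring.
    eapply Rle_trans; [apply Rabs_triang|]. lra. }
  lra.
Qed.

(** * Selection of the gradients *)

Definition tame_trace (K : R) (S : list (R * R)) (f : R * R -> R) (F : R * R -> R) (V : R * R -> R * R) : Prop :=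
  tame K F V /\ forall s, In s S -> F s = f s.

(** The predicate given to [epsilon] sees [f] only through its values on [S]; functions equal on [S]
    give equal predicates by extensionality, hence the very same vector. *)
Definition pick (K : R) (S : list (R * R)) (f : R * R -> R) (x : R * R) : R * R :=
  epsilon (inhabits (RtoC 0)) (fun w => exists G W, tame_trace K S f G W /\ w = W x).

Lemma pick_spec K S f x F V : tame_trace K S f F V ->
  exists G W, tame_trace K S f G W /\ pick K S f x = W x.
Proof.
intros H. unfold pick. apply epsilon_spec. exists (V x), F, V. auto.
Qed.

Lemma pick_ext K S f g x : (forall s, In s S -> f s = g s) -> pick K S f x = pick K S g x.
Proof.
intros H. unfold pick. f_equal. apply functional_extensionality. intros w.
apply propositional_extensionality.
split; intros (G & W & [HT HG] & E); exists G, W; (split; [split|]); auto;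
  intros s Hs; rewrite HG by auto; auto. symmetry; auto.
Qed.

Lemma tame_trace_incl K S S' f F V : incl S' S -> tame_trace K S f F V -> tame_trace K S' f F V.
Proof. intros Hi [H1 H2]. split; auto. Qed.

(** Subtract the two Taylor expansions at [x]: common values at two points fix the gradient along
    their chord. *)
Lemma tame_dot_diff K F V G W x y : tame K F V -> tame K G W -> F x = G x -> F y = G y ->
  Rabs (dot (V x - W x)%C (y - x)%C) <= 2 * K * Cmod (y - x)%C ^ 2.
Proof.
intros (_ & _ & HF) (_ & _ & HG) Ex Ey. specialize (HF x y). specialize (HG x y).
rewrite pdist_sym in HF, HG. unfold pdist in HF, HG. rewrite dot_Cminus_l.
apply Rabs_le_between in HF. apply Rabs_le_between in HG. apply Rabs_le_between. lra.
Qed.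

(** The comparisons along [b - a] and [c - a] form a linear system for [V a - W a]; [r] measures its
    amplification of errors and will be the scale. *)
Lemma tame_triple K F V G W a b c r : tame K F V -> tame K G W ->
  F a = G a -> F b = G b -> F c = G c -> 0 <= K ->
  det (b - a)%C (c - a)%C <> 0 ->
  pdist a b * pdist a c * (pdist a b + pdist a c) <= r * Rabs (det (b - a)%C (c - a)%C) ->
  Cmod (V a - W a)%C <= 2 * K * r.
Proof.
intros HF HG Ea Eb Ec HK Hd Hr.
pose proof (tame_dot_diff K F V G W a b HF HG Ea Eb) as Hb.
pose proof (tame_dot_diff K F V G W a c HF HG Ea Ec) as Hc.
pose proof (det_solve (b - a)%C (c - a)%C (V a - W a)%C) as Hs.
rewrite (pdist_sym a b), (pdist_sym a c) in Hr. unfold pdist in Hr.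
apply Rabs_pos_lt in Hd.
pose proof (Cmod_ge_0 (b - a)%C) as B0. pose proof (Cmod_ge_0 (c - a)%C) as C0.
apply (Rmult_le_reg_r (Rabs (det (b - a)%C (c - a)%C))); auto.
set (p := Cmod (b - a)%C) in *. set (q := Cmod (c - a)%C) in *.
eapply Rle_trans; [exact Hs|].
apply Rle_trans with (2 * K * (p * q * (p + q))).
- apply (Rmult_le_compat_r q) in Hb; auto. apply (Rmult_le_compat_r p) in Hc; auto. lra.
- apply (Rmult_le_compat_l (2 * K)) in Hr; lra.
Qed.

(* [|ab| |ac| (|ab| + |ac|) / |det|] bounds the circumradius of [abc] from above and, unlike it, is
   directly the constant in the linear system that recovers a gradient from its values on
   [b - a] and [c - a]. *)
Lemma triple_scale (E : list (R * R)) : exists s (T : R * R -> list (R * R)),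
  lip1 s /\ (forall x, 0 < s x) /\ (forall x, s x <= 1) /\
  (forall x, incl (T x) E /\ (length (T x) <= 3)%nat) /\
  (forall x, s x = 1 \/ exists a b c, T x = [a; b; c] /\ pdist x a <= s x /\
     det (b - a)%C (c - a)%C <> 0 /\
     pdist a b * pdist a c * (pdist a b + pdist a c) <= s x * Rabs (det (b - a)%C (c - a)%C)) /\
  (forall x a b c, In a E -> In b E -> In c E ->
     pdist x a < s x -> pdist x b < s x -> pdist x c < s x ->
     s x * Rabs (det (b - a)%C (c - a)%C) <= pdist a b * pdist a c * (pdist a b + pdist a c)).
Proof.
set (dt := fun t : (R * R) * (R * R) * (R * R) =>
  det (snd (fst t) - fst (fst t))%C (snd t - fst (fst t))%C).
set (num := fun t : (R * R) * (R * R) * (R * R) => let '(a, b, c) := t in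
  pdist a b * pdist a c * (pdist a b + pdist a c)).
(* Degenerate triples determine no gradient and are left out; with determinant 0 they satisfy the
   last clause trivially. *)
set (L := filter (fun t => if Req_EM_T (dt t) 0 then false else true)
           (list_prod (list_prod E E) E)).
set (h := fun t x => let '(a, b, c) := t in
  Rmax (Rmax (pdist x a) (pdist x b)) (Rmax (pdist x c) (num t / Rabs (dt t)))).
assert (HL : forall a b c, In (a, b, c) L <-> (In a E /\ In b E /\ In c E /\ dt (a, b, c) <> 0)).
{ intros a b c. unfold L. rewrite filter_In, !in_prod_iff.
  destruct (Req_EM_T (dt (a, b, c)) 0); intuition discriminate. }
destruct (scale_exists L h) as (s & H1 & (m & Hm & H2) & H3 & H4 & H5).
- intros [[a b] c] _. unfold h. repeat apply lip1_max; try apply lip1_pdist. apply lip1_const.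
- intros [[a b] c] Ht. apply HL in Ht. destruct Ht as (_ & _ & _ & Hd).
  exists (num (a, b, c) / Rabs (dt (a, b, c))). split.
  + apply Rdiv_lt_0_compat; [|now apply Rabs_pos_lt].
    assert (Hab : a <> b). { intros ->. apply Hd. unfold dt, det; simpl. ring. }
    assert (Hac : a <> c). { intros ->. apply Hd. unfold dt, det; simpl. ring. }
    apply pdist_gt_0 in Hab. apply pdist_gt_0 in Hac. unfold num.
    apply Rmult_lt_0_compat; [apply Rmult_lt_0_compat|]; lra.
  + intros x. unfold h. eapply Rle_trans; [|apply Rmax_r]. apply Rmax_r.
- assert (HT : forall x, exists T, incl T E /\ (length T <= 3)%nat /\
    (s x = 1 \/ exists a b c, T = [a; b; c] /\ pdist x a <= s x /\
     det (b - a)%C (c - a)%C <> 0 /\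
     pdist a b * pdist a c * (pdist a b + pdist a c) <= s x * Rabs (det (b - a)%C (c - a)%C))).
  { intros x. destruct (H5 x) as [E1|([[a b] c] & Hin & Hh)].
    - exists nil. split; [apply incl_nil_l|]. split; [simpl; lia|]. now left.
    - apply HL in Hin. destruct Hin as (Ia & Ib & Ic & Hd). exists [a; b; c].
      split; [intros y Hy; simpl in Hy; intuition congruence|]. split; [simpl; lia|].
      right. exists a, b, c. split; auto. unfold h in Hh. split; [|split; auto].
      + rewrite <- Hh. eapply Rle_trans; [|apply Rmax_l]. apply Rmax_l.
      + change (num (a, b, c) <= s x * Rabs (dt (a, b, c))). rewrite <- Hh.
        apply Rle_div_l; [now apply Rabs_pos_lt|].
        eapply Rle_trans; [|apply Rmax_r]. apply Rmax_r. }
  apply choice_fun in HT. destruct HT as [T HT].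
  exists s, T. split; auto. split; [intros x; specialize (H2 x); lra|]. split; auto.
  split; [intros x; split; apply (HT x)|]. split; [intros x; apply (HT x)|].
  intros x a b c Ia Ib Ic Da Db Dc.
  change (s x * Rabs (dt (a, b, c)) <= num (a, b, c)).
  destruct (Req_EM_T (dt (a, b, c)) 0) as [Hd|Hd].
  + rewrite Hd, Rabs_R0. unfold num.
    pose proof (pdist_ge_0 a b). pose proof (pdist_ge_0 a c).
    rewrite Rmult_0_r. apply Rmult_le_pos; [apply Rmult_le_pos|]; lra.
  + specialize (H4 x (a, b, c) (proj2 (HL a b c) (conj Ia (conj Ib (conj Ic Hd))))).
    (* The scale is at most the maximum [h], and the three distances are strictly below it, so the
       ratio must be the entry that bounds it. *)
    apply Rle_div_r; [now apply Rabs_pos_lt|].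
    unfold h in H4. revert H4. unfold Rmax. repeat destruct Rle_dec; lra.
Qed.

Lemma argmin_exists (L : list (R * R)) (h : R * R -> R) : L <> nil ->
  exists m, In m L /\ forall y, In y L -> h m <= h y.
Proof.
induction L as [|a L IH]; intros H. { congruence. }
destruct L as [|b L].
- exists a. split. now left. intros y [->|[]]. lra.
- destruct IH as (m & Hm & Hmin). { discriminate. }
  destruct (Rle_dec (h a) (h m)) as [Hle|Hle].
  + exists a. split. now left. intros y [->|Hy]. lra. specialize (Hmin y Hy). lra.
  + exists m. split. now right. intros y [->|Hy]. lra. auto.
Qed.

Lemma neighbour_exists (E : list (R * R)) : exists n : R * R -> R * R, forall x,
  (In x E -> In (n x) E) /\
  (forall y, In y E -> y <> x -> n x <> x /\ pdist x (n x) <= pdist x y).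
Proof.
apply (choice_fun (fun x m => (In x E -> In m E) /\
  (forall y, In y E -> y <> x -> m <> x /\ pdist x m <= pdist x y))). intros x.
set (L := filter (fun y => if excluded_middle_informative (y = x) then false else true) E).
assert (HL : forall y, In y L <-> In y E /\ y <> x).
{ intros y. unfold L. rewrite filter_In. destruct excluded_middle_informative; intuition discriminate. }
destruct L as [|a L'].
(* [E] has no point other than [x]; the default [n x = x] gives the zero direction. *)
- exists x. split; auto. intros y Hy Hne. exfalso. apply (HL y). auto.
- destruct (argmin_exists (a :: L') (pdist x)) as (m & Hm & Hmin). { discriminate. }
  exists m. apply HL in Hm. split; [tauto|]. intros y Hy Hne. split; [tauto|].
  apply Hmin, HL. auto.
Qed.

(* Blending one centre after the other replaces a partition of unity: no normalisation is needed,
   and a centre with [phi z = 1] overrides everything blended before it. *)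
Definition blendv (phi : R * R -> R) (gam : R * R -> R * R) (Z : list (R * R)) : R * R :=
  fold_right (fun z g => (g + phi z * (gam z - g))%C) (RtoC 0) Z.

Lemma blendv_cons phi gam z Z :
  blendv phi gam (z :: Z) = (blendv phi gam Z + phi z * (gam z - blendv phi gam Z))%C.
Proof. reflexivity. Qed.

(** The centre of weight 1 erases the initial value 0 and puts the blend into the ball; later convex
    combinations stay there. *)
Lemma blendv_ball phi gam Z c r z0 : In z0 Z -> phi z0 = 1 ->
  (forall z, 0 <= phi z <= 1) ->
  (forall z, In z Z -> phi z <> 0 -> Cmod (gam z - c)%C <= r) ->
  Cmod (blendv phi gam Z - c)%C <= r.
Proof.
intros Hz0 H1 H01. induction Z as [|z Z IH]; intros Hr. { destruct Hz0. }
rewrite blendv_cons. set (g := blendv phi gam Z) in *.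
destruct (Req_EM_T (phi z) 1) as [E1|E1].
- rewrite E1. replace (g + RtoC 1 * (gam z - g) - c)%C with (gam z - c)%C by cring.
  apply Hr. now left. lra.
- assert (IH' : Cmod (g - c)%C <= r).
  { apply IH. destruct Hz0; congruence. intros; apply Hr; auto. now right. }
  destruct (Req_EM_T (phi z) 0) as [E0|E0].
  + rewrite E0. replace (g + RtoC 0 * (gam z - g) - c)%C with (g - c)%C by cring. auto.
  + replace (g + RtoC (phi z) * (gam z - g) - c)%C
      with ((g - c) + RtoC (phi z) * ((gam z - c) - (g - c)))%C by cring.
    apply Cmod_convex; auto. apply Hr; auto. now left.
Qed.

(** Both blends agree right after [z0]. Each later active centre contracts the difference by
    [1 - phi z] and adds at most [e * (2 * r)], because its value and the current blend both lie
    within [r] of [c]. *)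
Lemma blendv_lip phi psi gam Z (p : R * R -> bool) c r e z0 : In z0 Z ->
  phi z0 = 1 -> psi z0 = 1 -> 0 <= e -> 0 <= r ->
  (forall z, 0 <= phi z <= 1) -> (forall z, 0 <= psi z <= 1) ->
  (forall z, In z Z -> p z = false -> phi z = 0 /\ psi z = 0) ->
  (forall z, In z Z -> p z = true -> Rabs (phi z - psi z) <= e /\ Cmod (gam z - c)%C <= r) ->
  Cmod (blendv phi gam Z - blendv psi gam Z)%C <= INR (length (filter p Z)) * (e * (2 * r)).
Proof.
intros Hz0 F1 S1 He Hr F01 S01. induction Z as [|z Z IH]; intros Hf Ht. { destruct Hz0. }
assert (Hc : forall n, 0 <= INR n * (e * (2 * r))).
{ intros n. apply Rmult_le_pos. apply pos_INR. apply Rmult_le_pos; lra. }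
destruct (excluded_middle_informative (phi z = 1 /\ psi z = 1)) as [[E1 E2]|Hn].
- replace (blendv phi gam (z :: Z) - blendv psi gam (z :: Z))%C with (RtoC 0).
  { rewrite Cmod_0. apply Hc. }
  rewrite !blendv_cons, E1, E2. cring.
- assert (Hz1 : In z0 Z). { destruct Hz0; auto. subst. tauto. }
  assert (IH' := IH Hz1 (fun z H => Hf z (or_intror H)) (fun z H => Ht z (or_intror H))).
  assert (HB : Cmod (blendv psi gam Z - c)%C <= r).
  { apply (blendv_ball _ _ _ _ _ z0); auto. intros z' Hz' H0.
    destruct (p z') eqn:Ep. apply (Ht z' (or_intror Hz') Ep).
    exfalso. apply H0. apply (Hf z' (or_intror Hz') Ep). }
  simpl filter. rewrite !blendv_cons. set (g := blendv phi gam Z) in *. set (k := blendv psi gam Z) in *.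
  destruct (p z) eqn:Ep.
  + destruct (Ht z (or_introl eq_refl) Ep) as [T1 T2].
    change (length (z :: filter p Z)) with (S (length (filter p Z))). rewrite S_INR.
    replace (g + RtoC (phi z) * (gam z - g) - (k + RtoC (psi z) * (gam z - k)))%C
      with (RtoC (1 - phi z) * (g - k) + RtoC (phi z - psi z) * ((gam z - c) - (k - c)))%C by cring.
    eapply Rle_trans; [apply Cmod_triangle|]. rewrite !Cmod_mult, !Cmod_R.
    assert (HX : Cmod ((gam z - c) - (k - c))%C <= 2 * r).
    { unfold Cminus at 1. eapply Rle_trans; [apply Cmod_triangle|]. rewrite Cmod_opp. lra. }
    assert (HY : Rabs (phi z - psi z) * Cmod ((gam z - c) - (k - c))%C <= e * (2 * r)).
    { apply Rmult_le_compat; auto using Rabs_pos, Cmod_ge_0. }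
    assert (HW : Rabs (1 - phi z) * Cmod (g - k)%C <= Cmod (g - k)%C).
    { specialize (F01 z). rewrite Rabs_right by lra. pose proof (Cmod_ge_0 (g - k)%C). nra. }
    lra.
  + destruct (Hf z (or_introl eq_refl) Ep) as [-> ->].
    replace (g + RtoC 0 * (gam z - g) - (k + RtoC 0 * (gam z - k)))%C with (g - k)%C by cring. auto.
Qed.

Lemma blendv_ext phi gam gam' Z : (forall z, In z Z -> phi z <> 0 -> gam z = gam' z) ->
  blendv phi gam Z = blendv phi gam' Z.
Proof.
induction Z as [|z Z IH]; intros H; auto.
rewrite !blendv_cons, IH by (intros; apply H; auto; now right).
destruct (Req_EM_T (phi z) 0) as [E0|E0].
- rewrite E0. cring.
- rewrite (H z (or_introl eq_refl) E0). auto.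
Qed.

Lemma blendv_0 phi gam Z : (forall z, In z Z -> phi z <> 0 -> gam z = RtoC 0) ->
  blendv phi gam Z = RtoC 0.
Proof.
intros H. rewrite (blendv_ext phi gam (fun _ => RtoC 0)) by auto.
induction Z as [|z Z IH]; auto.
rewrite blendv_cons, IH by (intros; apply H; auto; now right). cring.
Qed.

(** The plateau radius [s z / 8] is four times the covering radius of the net, so a point of [E] and
    all points within [s / 16] of it share a centre of weight 1. *)
Definition tent (s : R * R -> R) (x z : R * R) : R := Rmax 0 (Rmin 1 (2 - 8 * (pdist x z / s z))).

Lemma tent_01 s x z : 0 <= tent s x z <= 1.
Proof. unfold tent, Rmax, Rmin. repeat destruct Rle_dec; lra. Qed.

Lemma tent_1 s x z : 0 < s z -> pdist x z <= s z / 8 -> tent s x z = 1.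
Proof.
intros Hs H. assert (pdist x z / s z <= 1 / 8) by (apply Rle_div_l; lra).
unfold tent, Rmax, Rmin. repeat destruct Rle_dec; lra.
Qed.

Lemma tent_0 s x z : 0 < s z -> active s x z = false -> tent s x z = 0.
Proof.
intros Hs H. assert (Ha : ~ pdist x z <= s z / 4). { rewrite <- activeP. congruence. }
apply Rnot_le_lt in Ha.
assert (1 / 4 <= pdist x z / s z) by (apply (proj1 (Rle_div_r (1 / 4) _ _ Hs)); lra).
unfold tent, Rmax, Rmin. repeat destruct Rle_dec; lra.
Qed.

Lemma tent_lip s x y z : 0 < s z -> Rabs (tent s x z - tent s y z) <= 8 / s z * pdist x y.
Proof.
intros Hs.
assert (H : Rabs (pdist x z / s z - pdist y z / s z) <= pdist x y / s z).
{ unfold Rdiv. rewrite <- Rmult_minus_distr_r, Rabs_mult, (Rabs_right (/ s z)).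
  2:{ apply Rle_ge, Rlt_le, Rinv_0_lt_compat, Hs. }
  apply Rmult_le_compat_r. apply Rlt_le, Rinv_0_lt_compat, Hs.
  pose proof (pdist_tri y x z). pose proof (pdist_tri x y z). rewrite (pdist_sym y x) in *.
  apply Rabs_le_between. lra. }
replace (8 / s z * pdist x y) with (8 * (pdist x y / s z)) by (field; lra).
apply Rabs_le_between in H. apply Rabs_le_between.
unfold tent, Rmax, Rmin. repeat destruct Rle_dec; lra.
Qed.

Lemma tame_Cmod_le K F V x : 0 <= K -> tame K F V -> Cmod (V x) <= 2 * K.
Proof.
intros HK (HF & _). destruct (HF x) as [[H0 H1] H2].
pose proof (Cmod_ge_0 (V x)). assert (K * F x <= K * K) by (apply Rmult_le_compat_l; auto).
apply Rsqr_incr_0_var; [|lra]. rewrite !Rsqr_pow2. nra.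
Qed.

Lemma Cmod_Cminus_sym u v : Cmod (u - v)%C = Cmod (v - u)%C.
Proof. apply (pdist_sym u v). Qed.

Lemma length_flat_map_le {A B : Type} (h : A -> list B) L n :
  (forall a, In a L -> (length (h a) <= n)%nat) -> (length (flat_map h L) <= length L * n)%nat.
Proof.
induction L as [|a L IH]; intros H; simpl. lia.
rewrite length_app. specialize (IH (fun b Hb => H b (or_intror Hb))).
specialize (H a (or_introl eq_refl)). lia.
Qed.

Lemma length_filter_orb {A : Type} (p q : A -> bool) L :
  (length (filter (fun a => p a || q a)%bool L) <= length (filter p L) + length (filter q L))%nat.
Proof.
induction L as [|a L IH]; simpl. lia.
destruct (p a), (q a); simpl; lia.
Qed.

(** The test reads only the value at [z]. Below the threshold, 0 is as accurate as a reconstruction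
    and stays compatible with a small value of [f]. *)
Definition center_gradient (s : R * R -> R) (T : R * R -> list (R * R)) (K : R) (f : R * R -> R)
  (z : R * R) : R * R :=
  if Rle_dec (4 * K * s z ^ 2) (f z) then pick K (z :: T z) f z else RtoC 0.

(* If [f z < 4 * K * s z ^ 2], nonnegativity alone forces the gradient to be of size [K * s z]. *)
Lemma center_gradient_le s T K f z F V : 0 <= K -> 0 < s z ->
  (s z = 1 \/ exists a b c, T z = [a; b; c] /\ pdist z a <= s z /\
     det (b - a)%C (c - a)%C <> 0 /\
     pdist a b * pdist a c * (pdist a b + pdist a c) <= s z * Rabs (det (b - a)%C (c - a)%C)) ->
  tame_trace K (z :: T z) f F V ->
  Cmod (center_gradient s T K f z - V z)%C <= 4 * K * s z.
Proof.
intros HK Hs HT HF. unfold center_gradient. destruct Rle_dec as [Hle|Hlt].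
- destruct (pick_spec K (z :: T z) f z F V HF) as (G & W & [HG HGf] & ->).
  destruct HF as [HF HFf]. destruct HT as [E1|(a & b & c & ET & Ha & Hd & Hr)].
  + rewrite E1. unfold Cminus. eapply Rle_trans; [apply Cmod_triangle|]. rewrite Cmod_opp.
    pose proof (tame_Cmod_le K G W z HK HG). pose proof (tame_Cmod_le K F V z HK HF). lra.
  + rewrite ET in *.
    assert (HE : forall y, In y [z; a; b; c] -> G y = F y).
    { intros y Hy. rewrite HGf, HFf by exact Hy. auto. }
    pose proof (tame_triple K G W F V a b c (s z) HG HF (HE a ltac:(simpl; tauto))
      (HE b ltac:(simpl; tauto)) (HE c ltac:(simpl; tauto)) HK Hd Hr) as Ht.
    destruct HG as (_ & HG & _). destruct HF as (_ & HF & _).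
    specialize (HG z a). specialize (HF a z). rewrite (pdist_sym a z) in HF.
    replace (W z - V z)%C with ((W z - W a) + ((W a - V a) + (V a - V z)))%C by cring.
    eapply Rle_trans; [apply Cmod_triangle|].
    eapply Rle_trans; [apply Rplus_le_compat_l, Cmod_triangle|].
    assert (K * pdist z a <= K * s z) by (apply Rmult_le_compat_l; auto). lra.
- apply Rnot_le_lt in Hlt. destruct HF as [(HF & _) HFf].
  replace (RtoC 0 - V z)%C with (- V z)%C by cring. rewrite Cmod_opp.
  destruct (HF z) as [_ Hz]. rewrite (HFf z) in Hz by now left.
  assert (K * f z <= K * (4 * K * s z ^ 2)) by (apply Rmult_le_compat_l; lra).
  apply Rsqr_incr_0_var. 2: apply Rmult_le_pos; lra. rewrite !Rsqr_pow2. lra.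
Qed.

(** A large value persists over a quarter of the scale, because it controls its own gradient. The
    factor [25 / 16 = (5 / 4) ^ 2] absorbs the change of scale in [active_scale]. *)
Lemma tame_large K F V x y r : 0 < K -> tame K F V -> pdist x y <= r / 4 ->
  4 * K * r ^ 2 <= F x -> 25 / 16 * K * r ^ 2 <= F y.
Proof.
intros HK (H1 & _ & H3) Hd Hr. specialize (H3 x y). destruct (H1 x) as [_ Hg].
pose proof (dot_le (V x) (y - x)%C) as Hdot. change (Cmod (y - x)%C) with (pdist y x) in Hdot.
rewrite (pdist_sym y x) in Hdot. set (d := pdist x y) in *.
pose proof (pdist_ge_0 x y) as Hd0. fold d in Hd0.
apply Rabs_le_between in H3. apply Rabs_le_between in Hdot.
assert (Hd2 : d ^ 2 <= r ^ 2 / 16) by nra.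
(* AM-GM: [|V| d <= |V|^2 / (8 K) + 2 K d^2] *)
assert (HA : Cmod (V x) * d <= F x / 2 + 2 * K * d ^ 2).
{ apply (Rmult_le_reg_l (8 * K)); [lra|].
  pose proof (pow2_ge_0 (Cmod (V x) - 4 * K * d)). nra. }
assert (K * d ^ 2 <= K * (r ^ 2 / 16)) by (apply Rmult_le_compat_l; lra).
assert (0 <= K * r ^ 2) by (apply Rmult_le_pos; [lra|apply pow2_ge_0]).
lra.
Qed.

(** The alternative [g = 0] or [K * s x ^ 2 <= f x] will give [|v|^2 <= C K f]: a nonzero guess
    occurs only where [f] dominates its error. Each active centre contributes itself and a triangle
    to the list, four points. *)
Lemma background_field : exists N : nat, forall E : list (R * R),
  exists (s : R * R -> R) (T : R * R -> list (R * R))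
         (g : R -> (R * R -> R) -> R * R -> R * R),
  lip1 s /\ (forall x, 0 < s x) /\
  (forall x a b c, In a E -> In b E -> In c E ->
     pdist x a < s x -> pdist x b < s x -> pdist x c < s x ->
     s x * Rabs (det (b - a)%C (c - a)%C) <= pdist a b * pdist a c * (pdist a b + pdist a c)) /\
  (forall x, incl (T x) E /\ (length (T x) <= N * 4)%nat) /\
  (forall K f f' x, (forall y, In y (T x) -> f y = f' y) -> g K f x = g K f' x) /\
  (forall K f F V, 0 < K -> tame_trace K E f F V -> forall x, In x E ->
     Cmod (g K f x - V x)%C <= 7 * K * s x /\
     (g K f x = RtoC 0 \/ K * s x ^ 2 <= f x) /\
     forall y, In y E -> pdist x y <= s x / 16 ->
       Cmod (g K f x - g K f y)%C <= 308 * INR N * K * pdist x y).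
Proof.
destruct net_bounded_overlap as [N HN]. exists N. intros E.
destruct (triple_scale E) as (s & T & Hlip & Hpos & Hle1 & HT & HR1 & HR2).
destruct (net_exists s E Hlip Hpos) as (Z & HZE & HZnd & HZc & HZs).
pose proof (HN s Z Hlip Hpos HZnd HZs) as HZN.
exists s, (fun x => flat_map (fun z => z :: T z) (filter (active s x) Z)),
  (fun K f x => blendv (tent s x) (center_gradient s T K f) Z).
assert (Htent : forall x z, tent s x z <> 0 -> active s x z = true).
{ intros x z H. destruct (active s x z) eqn:Ea; auto. destruct H. now apply tent_0. }
split; [auto|]. split; [auto|]. split; [auto|]. split; [|split].
- intros x. split.
  + intros y Hy. apply in_flat_map in Hy. destruct Hy as (z & Hz & Hy).
    apply filter_In in Hz. destruct Hy as [<-|Hy]. apply HZE; tauto. now apply (HT z).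
  + eapply Nat.le_trans; [apply (length_flat_map_le _ _ 4)|].
    * intros z _. simpl. pose proof (proj2 (HT z)). lia.
    * specialize (HZN x). nia.
- intros K f f' x H. apply blendv_ext. intros z Hz Hphi. apply Htent in Hphi.
  assert (Hin : forall y, In y (z :: T z) -> f y = f' y).
  { intros y Hy. apply H. apply in_flat_map. exists z. split; auto.
    apply filter_In. auto. }
  unfold center_gradient. rewrite (Hin z) by now left.
  destruct Rle_dec; auto. now apply pick_ext.
- intros K f F V HK HF.
  assert (HC : forall z, In z Z -> Cmod (center_gradient s T K f z - V z)%C <= 4 * K * s z).
  { intros z Hz. apply (center_gradient_le s T K f z F V); auto. lra.
    apply (tame_trace_incl K E); auto. apply incl_cons. now apply HZE. apply HT. }
  destruct HF as [HF HFf]. pose proof HF as (HF1 & HF2 & HF3).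
  assert (Hcore : forall x, In x E -> exists z, In z Z /\ pdist x z <= s z / 32) by auto.
  assert (HB : forall x, forall z, In z Z -> active s x z = true ->
     s x <= 5 / 4 * s z /\ 3 / 4 * s z <= s x /\
     Cmod (center_gradient s T K f z - V x)%C <= 6 * K * s x).
  { intros x z Hz Ha. apply activeP in Ha. destruct (active_scale s x z Hlip Ha) as [S1 S2].
    split; auto. split; auto. specialize (HC z Hz). specialize (HF2 z x).
    rewrite pdist_sym in HF2.
    replace (center_gradient s T K f z - V x)%C
      with ((center_gradient s T K f z - V z) + (V z - V x))%C by cring.
    eapply Rle_trans; [apply Cmod_triangle|].
    assert (K * pdist x z <= K * (s x / 3)) by (apply Rmult_le_compat_l; lra).
    assert (K * (s z * (3 / 4)) <= K * s x) by (apply Rmult_le_compat_l; lra).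
    pose proof (Rmult_le_pos K (s x) (Rlt_le _ _ HK) (Rlt_le _ _ (Hpos x))). lra. }
  intros x Hx. destruct (Hcore x Hx) as (z0 & Hz0 & Hd0).
  assert (HKs : 0 <= K * s x) by (apply Rmult_le_pos; [lra|apply Rlt_le, Hpos]).
  assert (Ht0 : tent s x z0 = 1). { apply tent_1; auto. specialize (Hpos z0). lra. }
  split; [|split].
  + eapply Rle_trans; [apply (blendv_ball _ _ _ _ (6 * K * s x) z0); auto|lra].
    * apply tent_01.
    * intros z Hz Hphi. apply Htent in Hphi. now apply HB.
  + destruct (excluded_middle_informative (K * s x ^ 2 <= f x)) as [Hf|Hf]; auto.
    (* An active centre above the threshold would force [K * s x ^ 2 <= f x] by [tame_large]; hence
       all active centres contribute 0. *)
    left. apply blendv_0. intros z Hz Hphi. apply Htent in Hphi.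
    destruct (HB x z Hz Hphi) as (S1 & _ & _). apply activeP in Hphi.
    unfold center_gradient. destruct Rle_dec as [Hl|Hl]; auto. exfalso. apply Hf.
    rewrite <- (HFf z) in Hl by now apply HZE. rewrite <- (HFf x) by auto.
    rewrite pdist_sym in Hphi. eapply Rle_trans; [|apply (tame_large K F V z x (s z) HK HF Hphi Hl)].
    replace (25 / 16 * K * s z ^ 2) with (K * (5 / 4 * s z) ^ 2) by field.
    apply Rmult_le_compat_l; [lra|]. apply pow_incr. specialize (Hpos x). lra.
  + intros y Hy Hxy.
    pose proof (Hlip x y) as L1. pose proof (Hlip y x) as L2. rewrite (pdist_sym y x) in L2.
    assert (Hty : tent s y z0 = 1).
    { apply tent_1; auto. pose proof (pdist_tri x y z0). rewrite (pdist_sym y x) in *.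
      pose proof (Hlip x z0). specialize (Hpos z0). lra. }
    eapply Rle_trans.
    (* At most [2 * N] centres act at [x] or [y]; weights varying by [11 / s x * pdist x y] and
       guesses in a ball of radius [7 * K * s x] give [308 = 2 * 11 * 14]. *)
    { apply (blendv_lip _ _ _ Z (fun z => active s x z || active s y z)%bool (V x)
        (7 * K * s x) (11 / s x * pdist x y) z0); auto using tent_01.
      - apply Rmult_le_pos. 2: apply pdist_ge_0.
        apply Rlt_le, Rdiv_lt_0_compat; [lra|auto].
      - lra.
      - intros z Hz Hp. apply Bool.orb_false_iff in Hp.
        split; (apply tent_0; [auto|tauto]).
      - intros z Hz Hp.
        assert (HS : s x <= 11 / 8 * s z).
        { apply Bool.orb_true_iff in Hp. destruct Hp as [Hp|Hp].
          - destruct (HB x z Hz Hp) as (S1 & _ & _). specialize (Hpos z). lra.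
          - destruct (HB y z Hz Hp) as (S1 & _ & _). specialize (Hpos z). lra. }
        split.
        + eapply Rle_trans; [apply tent_lip; auto|]. apply Rmult_le_compat_r. apply pdist_ge_0.
          apply (Rmult_le_reg_r (s x * s z)); [apply Rmult_lt_0_compat; auto|].
          replace (8 / s z * (s x * s z)) with (8 * s x) by (field; apply Rgt_not_eq, Hpos).
          replace (11 / s x * (s x * s z)) with (11 * s z) by (field; apply Rgt_not_eq, Hpos).
          lra.
        + apply Bool.orb_true_iff in Hp. destruct Hp as [Hp|Hp].
          * destruct (HB x z Hz Hp) as (_ & _ & S3). lra.
          * destruct (HB y z Hz Hp) as (_ & _ & S3).
            replace (center_gradient s T K f z - V x)%C
              with ((center_gradient s T K f z - V y) + (V y - V x))%C by cring.
            eapply Rle_trans; [apply Cmod_triangle|].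
            specialize (HF2 y x). rewrite (pdist_sym y x) in HF2.
            assert (K * pdist x y <= K * (s x / 16)) by (apply Rmult_le_compat_l; lra).
            assert (K * s y <= K * (17 / 16 * s x)) by (apply Rmult_le_compat_l; lra).
            lra. }
    assert (HNN : INR (length (filter (fun z => active s x z || active s y z)%bool Z)) <= 2 * INR N).
    { rewrite <- mult_INR with (n := 2%nat). apply le_INR.
      pose proof (length_filter_orb (active s x) (active s y) Z).
      pose proof (HZN x). pose proof (HZN y). lia. }
    replace (11 / s x * pdist x y * (2 * (7 * K * s x))) with (154 * (K * pdist x y)).
    2:{ field. apply Rgt_not_eq, Hpos. }
    assert (0 <= K * pdist x y) by (apply Rmult_le_pos; [lra|apply pdist_ge_0]).
    nra.
Qed.

(** Whitney's compatibility of first order jets, together with the discriminant condition under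
    which each jet has a nonnegative quadratic extension. *)
Definition whitney_field (K : R) (E : list (R * R)) (f : R * R -> R) (v : R * R -> R * R) : Prop :=
  forall x, In x E -> 0 <= f x <= K /\ Cmod (v x) ^ 2 <= 4 * K * f x /\
    forall y, In y E -> Cmod (v x - v y)%C <= K * pdist x y /\
      Rabs (f y - f x - dot (v x) (y - x)%C) <= K * pdist x y ^ 2.

Lemma Cminus_neq_0 (a b : R * R) : a <> b -> (a - b)%C <> (0, 0).
Proof.
intros H H0. apply H. replace a with ((a - b) + b)%C by cring. rewrite H0. cring.
Qed.

(** In the constant, [616 = 2 * 308], as the variation of [g] enters directly and once more under a
    projection; 500 covers the far case, whose terms add up to 467, and the size bound [20 ^ 2]. *)
Lemma gradient_selection : exists (C : R) (N : nat), 1 <= C /\ forall E : list (R * R),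
  exists (S : R * R -> list (R * R)) (v : R -> (R * R -> R) -> R * R -> R * R),
  (forall x, In x E -> incl (S x) E /\ In x (S x) /\ (length (S x) <= N)%nat) /\
  (forall K f f' x, (forall y, In y (S x) -> f y = f' y) -> v K f x = v K f' x) /\
  (forall K f F V, 0 < K -> tame_trace K E f F V -> whitney_field (C * K) E f (v K f)).
Proof.
destruct background_field as [N HN].
pose proof (pos_INR N) as HN0.
exists (616 * INR N + 500), (2 + N * 4)%nat. split; [lra|]. intros E.
destruct (HN E) as (s & T & g & Hlip & Hpos & Hcurv & HT & Hgext & Hg). clear HN.
destruct (neighbour_exists E) as [n Hn].
exists (fun x => x :: n x :: T x),
  (fun K f x => g K f x + proj (n x - x) (pick K [x; n x] f x - g K f x))%C.
split; [|split].
- intros x Hx. split; [|split; [now left|]].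
  + apply incl_cons; [auto|]. apply incl_cons; [now apply Hn|apply HT].
  + simpl. pose proof (proj2 (HT x)). lia.
- intros K f f' x H. rewrite (Hgext K f f' x). 2: { intros y Hy. apply H. simpl; auto. }
  rewrite (pick_ext K [x; n x] f f'); auto.
  intros y Hy. apply H. simpl in *; tauto.
- intros K f F V HK HF. pose proof HF as [Ht HFf]. pose proof Ht as (HF1 & HF2 & HF3).
  set (C := 616 * INR N + 500) in *.
  set (w := fun x => pick K [x; n x] f x).
  set (v := fun x => (g K f x + proj (n x - x) (w x - g K f x))%C).
  change (whitney_field (C * K) E f v).
  assert (Hw : forall x, In x E -> Cmod (w x) ^ 2 <= 4 * K * f x /\
     Cmod (proj (n x - x) (w x - V x))%C <= 2 * K * pdist x (n x)).
  { intros x Hx. assert (Hi : incl [x; n x] E).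
    { apply incl_cons; auto. apply incl_cons. now apply Hn. apply incl_nil_l. }
    destruct (pick_spec K [x; n x] f x F V (tame_trace_incl _ _ _ _ _ _ Hi HF)) as (G & W & [HG HGf] & Ew).
    unfold w. rewrite Ew. pose proof HG as (HG1 & _). split.
    - destruct (HG1 x) as [_ H]. rewrite <- (HGf x) by now left. exact H.
    - assert (HE : forall y, In y [x; n x] -> G y = F y).
      { intros y Hy. rewrite HGf, HFf; auto. }
      rewrite pdist_sym. unfold pdist. apply proj_dot_le; [lra|].
      replace (dot (n x - x)%C (W x - V x)%C) with (dot (W x - V x)%C (n x - x)%C)
        by (unfold dot; ring).
      apply (tame_dot_diff K G W F V); auto; apply HE; simpl; auto. }
  set (h := fun x => (V x - g K f x)%C).
  (* [v x = V x - (h x - proj h x) + O(K * |n x - x|)] *)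
  assert (Hv : forall x, v x = (V x - (h x - proj (n x - x) (h x)) + proj (n x - x) (w x - V x))%C).
  { intros x. unfold v, h. rewrite !proj_Cminus. cring. }
  assert (Hh : forall x, In x E -> Cmod (h x) <= 7 * K * s x).
  { intros x Hx. unfold h. rewrite Cmod_Cminus_sym. now apply (Hg K f F V HK HF). }
  assert (HvV : forall x, In x E -> Cmod (v x - V x)%C <= 14 * (K * s x) + 2 * (K * pdist x (n x))).
  { intros x Hx. rewrite Hv.
    replace (V x - (h x - proj (n x - x) (h x)) + proj (n x - x) (w x - V x) - V x)%C
      with (proj (n x - x) (h x) + (- h x + proj (n x - x) (w x - V x)))%C by cring.
    eapply Rle_trans; [apply Cmod_triangle|].
    eapply Rle_trans; [apply Rplus_le_compat_l, Cmod_triangle|]. rewrite Cmod_opp.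
    pose proof (proj_le (n x - x)%C (h x)). specialize (Hh x Hx).
    destruct (Hw x Hx) as [_ H2]. lra. }
  (* The triples [x, n x, y] and [y, n y, x] lie within [s x] of [x], so the curvature bound
     applies: both neighbour directions make an angle of order [pdist x y / s x] with [y - x]. A
     neighbour is no farther than the other point, whence the factor 2. *)
  assert (Hang : forall x y, In x E -> In y E -> x <> y -> pdist x y <= s x / 16 ->
     s x * Rabs (det (n x - x)%C (y - x)%C) <= 2 * Cmod (n x - x)%C * pdist x y ^ 2 /\
     s x * Rabs (det (n y - y)%C (y - x)%C) <= 2 * Cmod (n y - y)%C * pdist x y ^ 2).
  { intros x y Hx Hy Hne Hd. pose proof (Hpos x) as Hs.
    destruct (proj2 (Hn x) y Hy (fun e => Hne (eq_sym e))) as [_ Nx].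
    destruct (proj2 (Hn y) x Hx Hne) as [_ Ny]. rewrite (pdist_sym y x) in Ny.
    pose proof (proj1 (Hn x) Hx) as Inx. pose proof (proj1 (Hn y) Hy) as Iny.
    change (Cmod (n x - x)%C) with (pdist (n x) x). change (Cmod (n y - y)%C) with (pdist (n y) y).
    rewrite (pdist_sym (n x)), (pdist_sym (n y)).
    pose proof (pdist_ge_0 x (n x)). pose proof (pdist_ge_0 y (n y)). pose proof (pdist_ge_0 x y).
    pose proof (pdist_tri y x (n y)).
    assert (Hxx : pdist x x < s x) by (rewrite pdist_refl; auto).
    split.
    - eapply Rle_trans; [apply (Hcurv x x (n x) y); auto; lra|].
      assert (0 <= pdist x (n x) * pdist x y) by (apply Rmult_le_pos; auto). nra.
    - replace (Rabs (det (n y - y)%C (y - x)%C)) with (Rabs (det (n y - y)%C (x - y)%C)).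
      2:{ rewrite <- Rabs_Ropp. f_equal. unfold det; simpl; ring. }
      eapply Rle_trans; [apply (Hcurv x y (n y) x); auto; lra|]. rewrite (pdist_sym y x).
      assert (0 <= pdist y (n y) * pdist x y) by (apply Rmult_le_pos; auto). nra. }
  intros x Hx. rewrite <- (HFf x Hx). destruct (HF1 x) as [HF01 HFg].
  assert (HCK : K <= C * K) by (unfold C; nra).
  split; [lra|]. split.
  { destruct (Hw x Hx) as [Hwx _]. rewrite <- (HFf x Hx) in Hwx.
    assert (HKF : 0 <= K * F x) by (apply Rmult_le_pos; lra).
    destruct (Hg K f F V HK HF x Hx) as (Hg1 & Hg2 & _). rewrite <- (HFf x Hx) in Hg2.
    apply Rle_trans with (400 * (K * F x)).
    2:{ unfold C. pose proof (Rmult_le_pos _ _ HN0 HKF). lra. }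
    (* [q] is the size that nonnegativity allows for a gradient at [x]. If [g] vanishes, [v] is a
       projection of [w]; otherwise [K * s x <= q], and the error of [g] is of order [q] too. *)
    set (q := sqrt (K * F x)). assert (Hq : q ^ 2 = K * F x) by (apply pow2_sqrt; auto).
    assert (Hq0 : 0 <= q) by apply sqrt_pos.
    assert (Hroot : forall a, 0 <= a -> a ^ 2 <= 4 * K * F x -> a <= 2 * q).
    { intros a Ha H. apply Rsqr_incr_0_var; [|lra]. rewrite !Rsqr_pow2. lra. }
    assert (Hwq : Cmod (w x) <= 2 * q) by (apply Hroot; auto; apply Cmod_ge_0).
    assert (HVq : Cmod (V x) <= 2 * q) by (apply Hroot; auto; apply Cmod_ge_0).
    assert (Hvq : Cmod (v x) <= 20 * q).
    { destruct Hg2 as [Hg2|Hg2].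
      - replace (v x) with (proj (n x - x)%C (w x)).
        2:{ unfold v. rewrite Hg2, proj_Cminus.
            replace (proj (n x - x) (RtoC 0))%C with (RtoC 0) by (apply injective_projections; unfold proj, dot, Rdiv; simpl; ring).
            cring. }
        pose proof (proj_le (n x - x)%C (w x)). lra.
      - assert (Hsq : K * s x <= q).
        { apply Rsqr_incr_0_var; auto. rewrite !Rsqr_pow2, Hq.
          replace ((K * s x) ^ 2) with (K * (K * s x ^ 2)) by ring. apply Rmult_le_compat_l; lra. }
        assert (Hgq : Cmod (g K f x) <= 9 * q).
        { replace (g K f x) with ((g K f x - V x) + V x)%C by cring.
          eapply Rle_trans; [apply Cmod_triangle|]. lra. }
        unfold v. eapply Rle_trans; [apply Cmod_triangle|].
        pose proof (proj_le (n x - x)%C (w x - g K f x)%C).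
        assert (Cmod (w x - g K f x)%C <= 11 * q).
        { unfold Cminus. eapply Rle_trans; [apply Cmod_triangle|]. rewrite Cmod_opp. lra. }
        lra. }
    pose proof (Cmod_ge_0 (v x)). nra. }
  intros y Hy. destruct (excluded_middle_informative (x = y)) as [->|Hne].
  { rewrite pdist_refl. replace (v y - v y)%C with (RtoC 0) by cring. rewrite Cmod_0.
    rewrite (HFf y Hy).
    replace (f y - f y - dot (v y) (y - y)%C) with 0 by (unfold dot; simpl; ring).
    rewrite Rabs_R0. split; lra. }
  destruct (proj2 (Hn x) y Hy (fun e => Hne (eq_sym e))) as [Nx0 Nx].
  destruct (proj2 (Hn y) x Hx Hne) as [Ny0 Ny]. rewrite (pdist_sym y x) in Ny.
  apply (Rmult_le_compat_l K) in Nx; [|lra]. apply (Rmult_le_compat_l K) in Ny; [|lra].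
  pose proof (HF2 x y) as HVxy. pose proof (HF3 x y) as HTxy.
  rewrite <- (HFf y Hy).
  pose proof (pdist_ge_0 x y) as HD0. set (D := pdist x y) in *.
  assert (HKD : 0 <= K * D) by (apply Rmult_le_pos; lra).
  assert (HNKD : 0 <= INR N * (K * D)) by (apply Rmult_le_pos; lra).
  (* [V] already satisfies Taylor's bound with constant [K], so only the component of [v - V] along
     the chord matters. *)
  assert (Htay : forall c, Rabs (dot (v x - V x)%C (y - x)%C) <= c * (K * D * D) -> c <= 499 ->
    Rabs (F y - F x - dot (v x) (y - x)%C) <= C * K * D ^ 2).
  { intros c Hc Hc'.
    replace (F y - F x - dot (v x) (y - x)%C)
      with ((F y - F x - dot (V x) (y - x)%C) + - dot (v x - V x)%C (y - x)%C)
      by (unfold dot; simpl; ring).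
    eapply Rle_trans; [apply Rabs_triang|]. rewrite Rabs_Ropp.
    assert (0 <= K * D * D) by (apply Rmult_le_pos; auto).
    assert (c * (K * D * D) <= 499 * (K * D * D)) by (apply Rmult_le_compat_r; auto).
    assert (0 <= INR N * (K * D) * D) by (apply Rmult_le_pos; auto).
    unfold C. lra. }
  destruct (Rle_dec D (s x / 16)) as [Hnear|Hfar].
  + destruct (Hang x y Hx Hy Hne Hnear) as [A1 A2]. fold D in A1, A2.
    pose proof (Hpos x) as Hs. pose proof (Hlip y x) as Hsy. rewrite (pdist_sym y x) in Hsy. fold D in Hsy.
    assert (He0 : (y - x)%C <> (0, 0)) by (apply Cminus_neq_0; congruence).
    assert (Hux : (n x - x)%C <> (0, 0)) by (now apply Cminus_neq_0).
    assert (Huy : (n y - y)%C <> (0, 0)) by (now apply Cminus_neq_0).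
    assert (HeD : Cmod (y - x)%C = D) by apply (pdist_sym y x).
    assert (HDp : 0 < D) by (rewrite <- HeD; now apply Cmod_gt_0).
    pose proof (proj1 (Cmod_gt_0 _) Hux) as Hux'. pose proof (proj1 (Cmod_gt_0 _) Huy) as Huy'.
    assert (Hproj : forall u z, u <> (0, 0) -> s x * Rabs (det u (y - x)%C) <= 2 * Cmod u * D ^ 2 ->
      s x * Cmod (proj u z - proj (y - x) z)%C <= 2 * D * Cmod z).
    { intros u z Hu Hdet. pose proof (proj_diff u (y - x)%C z Hu He0) as Hp. rewrite HeD in Hp.
      pose proof (proj1 (Cmod_gt_0 _) Hu) as Hu'. pose proof (Cmod_ge_0 z) as Hz.
      apply (Rmult_le_reg_r (Cmod u * D)). { apply Rmult_lt_0_compat; auto. }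
      apply (Rmult_le_compat_l (s x)) in Hp; [|lra].
      apply (Rmult_le_compat_r (Cmod z)) in Hdet; [|auto]. lra. }
    destruct (Hg K f F V HK HF x Hx) as (_ & _ & Hgxy). specialize (Hgxy y Hy Hnear). fold D in Hgxy.
    pose proof (Hh x Hx) as Hhx. pose proof (Hh y Hy) as Hhy.
    assert (Hhy' : Cmod (h y) <= 8 * (K * s x)).
    { assert (K * s y <= K * (17 / 16 * s x)) by (apply Rmult_le_compat_l; lra).
      pose proof (Rmult_lt_0_compat K (s x) HK Hs). lra. }
    split.
    (* In order: the variation of [g]; the errors of the two picks along their axes; the variation
       of [V - g] on one axis; and [h y], of size [K * s x], projected on two axes. These are
       compared through the axis [y - x], at angles of order [D / s x]. *)
    * replace (v x - v y)%C with
        ((g K f x - g K f y) + (proj (n x - x) (w x - V x) + (- proj (n y - y) (w y - V y)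
         + (proj (n x - x) ((V x - V y) - (g K f x - g K f y))
         + ((proj (n x - x) (h y) - proj (y - x) (h y)) + - (proj (n y - y) (h y) - proj (y - x) (h y)))))))%C.
      2:{ unfold v, h. rewrite !proj_Cminus. cring. }
      eapply Rle_trans; [apply Cmod_triangle|].
      eapply Rle_trans; [apply Rplus_le_compat_l, Cmod_triangle|].
      eapply Rle_trans; [apply Rplus_le_compat_l, Rplus_le_compat_l, Cmod_triangle|].
      eapply Rle_trans; [apply Rplus_le_compat_l, Rplus_le_compat_l, Rplus_le_compat_l, Cmod_triangle|].
      eapply Rle_trans; [do 4 apply Rplus_le_compat_l; apply Cmod_triangle|].
      rewrite !Cmod_opp.
      destruct (Hw x Hx) as [_ W1]. destruct (Hw y Hy) as [_ W2].
      assert (B3 : Cmod (proj (n x - x) ((V x - V y) - (g K f x - g K f y)))%C <= K * D + 308 * (INR N * (K * D))).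
      { eapply Rle_trans; [apply proj_le|]. unfold Cminus at 1.
        eapply Rle_trans; [apply Cmod_triangle|]. rewrite Cmod_opp. lra. }
      assert (B4 : forall u, u <> (0, 0) -> s x * Rabs (det u (y - x)%C) <= 2 * Cmod u * D ^ 2 ->
        Cmod (proj u (h y) - proj (y - x) (h y))%C <= 16 * (K * D)).
      { intros u Hu Hdet. apply (Rmult_le_reg_l (s x)); auto.
        eapply Rle_trans; [apply Hproj; auto|].
        apply (Rmult_le_compat_l (2 * D)) in Hhy'; lra. }
      pose proof (B4 _ Hux A1). pose proof (B4 _ Huy A2). unfold C. lra.
    * apply (Htay 16); [|lra]. rewrite Hv.
      replace (V x - (h x - proj (n x - x) (h x)) + proj (n x - x) (w x - V x) - V x)%C
        with (proj (n x - x) (w x - V x) - (h x - proj (n x - x) (h x)))%C by cring.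
      rewrite dot_Cminus_l. unfold Rminus. eapply Rle_trans; [apply Rabs_triang|]. rewrite Rabs_Ropp.
      pose proof (dot_le (proj (n x - x) (w x - V x))%C (y - x)%C) as P1. rewrite HeD in P1.
      destruct (Hw x Hx) as [_ W1].
      assert (P2 : Cmod (proj (n x - x) (w x - V x))%C * D <= 2 * (K * D) * D).
      { apply Rmult_le_compat_r; lra. }
      pose proof (proj_orth (n x - x)%C (h x) (y - x)%C Hux) as P3.
      (* The vector is normal to [n x - x], from which [y - x] deviates by an angle of order
         [D / s x]; the scale cancels against [|h x| <= 7 * K * s x]. *)
      assert (P4 : Rabs (dot (h x - proj (n x - x) (h x))%C (y - x)%C) <= 14 * (K * D * D)).
      { apply (Rmult_le_reg_r (Cmod (n x - x)%C * s x)). { apply Rmult_lt_0_compat; auto. }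
        apply (Rmult_le_compat_r (s x)) in P3; [|lra].
        apply (Rmult_le_compat_l (Cmod (h x))) in A1; [|apply Cmod_ge_0].
        assert (Cmod (h x) * (2 * Cmod (n x - x)%C * D ^ 2) <= 7 * K * s x * (2 * Cmod (n x - x)%C * D ^ 2)).
        { apply Rmult_le_compat_r; auto. apply Rmult_le_pos; [lra|apply pow2_ge_0]. }
        lra. }
      lra.
  (* Now [s x < 16 * D] and [s y < 17 * D], so the deviation of [v] from [V] is already of order
     [K * D]; [226 = 14 * 16 + 2]. *)
  + apply Rnot_le_lt in Hfar.
    pose proof (Hlip y x) as Hsy. rewrite (pdist_sym y x) in Hsy. fold D in Hsy.
    pose proof (HvV x Hx) as Vx. pose proof (HvV y Hy) as Vy.
    assert (K * s x <= K * (16 * D)) by (apply Rmult_le_compat_l; lra).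
    assert (K * s y <= K * (17 * D)) by (apply Rmult_le_compat_l; lra).
    split.
    * replace (v x - v y)%C with ((v x - V x) + ((V x - V y) + - (v y - V y)))%C by cring.
      eapply Rle_trans; [apply Cmod_triangle|].
      eapply Rle_trans; [apply Rplus_le_compat_l, Cmod_triangle|]. rewrite Cmod_opp.
      unfold C. lra.
    * apply (Htay 226); [|lra].
      eapply Rle_trans; [apply dot_le|]. change (Cmod (y - x)%C) with (pdist y x).
      rewrite (pdist_sym y x). fold D.
      replace (226 * (K * D * D)) with (226 * (K * D) * D) by ring.
      apply Rmult_le_compat_r; auto. lra.
Qed.

(** * Second order jets and cutoffs *)

(** With derivatives carried as data, gluing becomes algebra on jets, and local dependence of all
    derivatives up to order two is one equality of jets. A single mixed entry serves both orders of
    differentiation. *)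
Record jet := Jet { j0 : R; jx : R; jy : R; jxx : R; jxy : R; jyy : R }.

Definition jcomp (alpha : nat * nat) : jet -> R :=
  match alpha with
  | (0, 0)%nat => j0 | (1, 0)%nat => jx | (0, 1)%nat => jy
  | (2, 0)%nat => jxx | (1, 1)%nat => jxy | _ => jyy
  end.

Definition is_jet (F : R * R -> jet) : Prop :=
  (forall a b,
    (is_derive (fun t => j0 (F (t, b))) a (jx (F (a, b))) /\
     is_derive (fun t => j0 (F (a, t))) b (jy (F (a, b)))) /\
    (is_derive (fun t => jx (F (t, b))) a (jxx (F (a, b))) /\
     is_derive (fun t => jx (F (a, t))) b (jxy (F (a, b)))) /\
    (is_derive (fun t => jy (F (t, b))) a (jxy (F (a, b))) /\
     is_derive (fun t => jy (F (a, t))) b (jyy (F (a, b))))) /\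
  (forall alpha, In alpha mindices2 -> forall p, continuous (fun q => jcomp alpha (F q)) p).

Lemma is_jet_derivatives F : is_jet F ->
  dx (fun q => j0 (F q)) = (fun q => jx (F q)) /\ dy (fun q => j0 (F q)) = (fun q => jy (F q)) /\
  dx (fun q => jx (F q)) = (fun q => jxx (F q)) /\ dx (fun q => jy (F q)) = (fun q => jxy (F q)) /\
  dy (fun q => jy (F q)) = (fun q => jyy (F q)).
Proof.
intros [H _].
repeat split; apply functional_extensionality; intros [a b]; unfold dx, dy; simpl;
  apply is_derive_unique, H.
Qed.

Lemma partial_is_jet F alpha : is_jet F -> In alpha mindices2 ->
  partial alpha (fun q => j0 (F q)) = (fun q => jcomp alpha (F q)).
Proof.
intros HF Ha. destruct (is_jet_derivatives F HF) as (E1 & E2 & E3 & E4 & E5).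
simpl in Ha. unfold partial.
destruct Ha as [<-|[<-|[<-|[<-|[<-|[<-|[]]]]]]]; simpl; rewrite ?E1, ?E2, ?E3, ?E4, ?E5; auto.
Qed.

Lemma is_C2_is_jet F : is_jet F -> is_C2 (fun q => j0 (F q)).
Proof.
intros HF. split.
- destruct (is_jet_derivatives F HF) as (E1 & E2 & _). rewrite E1, E2.
  destruct HF as [HF _]. intros [a b]. unfold ex_dx, ex_dy; simpl.
  destruct (HF a b) as ((H1 & H2) & (H3 & H4) & (H5 & H6)).
  repeat split; eexists; eassumption.
- intros alpha Ha p. rewrite (partial_is_jet F alpha HF Ha). now apply HF.
Qed.

Definition jzero := Jet 0 0 0 0 0 0.
Definition jone := Jet 1 0 0 0 0 0.
Definition jadd (a b : jet) := Jet (j0 a + j0 b) (jx a + jx b) (jy a + jy b)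
  (jxx a + jxx b) (jxy a + jxy b) (jyy a + jyy b).
Definition jsub (a b : jet) := Jet (j0 a - j0 b) (jx a - jx b) (jy a - jy b)
  (jxx a - jxx b) (jxy a - jxy b) (jyy a - jyy b).
Definition jmul (a b : jet) := Jet (j0 a * j0 b)
  (jx a * j0 b + j0 a * jx b) (jy a * j0 b + j0 a * jy b)
  (jxx a * j0 b + 2 * jx a * jx b + j0 a * jxx b)
  (jxy a * j0 b + jx a * jy b + jy a * jx b + j0 a * jxy b)
  (jyy a * j0 b + 2 * jy a * jy b + j0 a * jyy b).

Ltac split_jet := split; [split|split; split].

Lemma is_derive_eq (f : R -> R) (x l l' : R) : is_derive f x l' -> l' = l -> is_derive f x l.
Proof. intros H <-. exact H. Qed.

Lemma is_derive_Rmult (f g : R -> R) (x a b : R) : is_derive f x a -> is_derive g x b ->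
  is_derive (fun t => f t * g t) x (a * g x + f x * b).
Proof. intros Hf Hg. apply (is_derive_mult f g x a b Hf Hg). intros; apply Rmult_comm. Qed.

Lemma is_derive_Rplus (f g : R -> R) (x a b : R) : is_derive f x a -> is_derive g x b ->
  is_derive (fun t => f t + g t) x (a + b).
Proof. apply (is_derive_plus (V := R_NormedModule)). Qed.

Lemma is_derive_Rminus (f g : R -> R) (x a b : R) : is_derive f x a -> is_derive g x b ->
  is_derive (fun t => f t - g t) x (a - b).
Proof. apply (is_derive_minus (V := R_NormedModule)). Qed.

Lemma is_derive_Rscal (f : R -> R) (k x a : R) : is_derive f x a ->
  is_derive (fun t => k * f t) x (k * a).
Proof. apply (is_derive_scal f x k a). Qed.

Lemma is_derive_Rscal_r (f : R -> R) (k x a : R) : is_derive f x a ->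
  is_derive (fun t => f t * k) x (a * k).
Proof.
intros H. eapply is_derive_eq.
- apply (is_derive_Rmult f (fun _ => k) x a 0 H).
  apply (is_derive_const (K := R_AbsRing) (V := R_NormedModule)).
- ring.
Qed.

Ltac derive_rules :=
  match goal with
  | |- is_derive (fun _ => _ + _) _ _ => apply is_derive_Rplus; derive_rules
  | |- is_derive (fun _ => _ * _) _ _ => apply is_derive_Rmult; derive_rules
  | |- _ => eassumption
  end.

Lemma continuous_Rplus (f g : R * R -> R) p : continuous f p -> continuous g p ->
  continuous (fun q => f q + g q) p.
Proof. apply (continuous_plus (K := R_AbsRing) (V := R_NormedModule)). Qed.

Lemma continuous_Rminus (f g : R * R -> R) p : continuous f p -> continuous g p ->
  continuous (fun q => f q - g q) p.
Proof. apply (continuous_minus (K := R_AbsRing) (V := R_NormedModule)). Qed.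

Lemma continuous_Rmult (f g : R * R -> R) p : continuous f p -> continuous g p ->
  continuous (fun q => f q * g q) p.
Proof. apply (continuous_mult (K := R_AbsRing)). Qed.

Lemma mindices2_ind (P : nat * nat -> Prop) :
  P (0, 0)%nat -> P (1, 0)%nat -> P (0, 1)%nat -> P (2, 0)%nat -> P (1, 1)%nat -> P (0, 2)%nat ->
  forall alpha, In alpha mindices2 -> P alpha.
Proof. simpl. intros. intuition (subst; auto). Qed.

Lemma continuous_jcomp (F : R * R -> jet) : (forall alpha, In alpha mindices2 -> forall p, continuous (fun q => jcomp alpha (F q)) p) ->
  forall p, continuous (fun q => j0 (F q)) p /\ continuous (fun q => jx (F q)) p /\
    continuous (fun q => jy (F q)) p /\ continuous (fun q => jxx (F q)) p /\
    continuous (fun q => jxy (F q)) p /\ continuous (fun q => jyy (F q)) p.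
Proof.
intros H p.
split; [apply (H (0, 0)%nat)|split; [apply (H (1, 0)%nat)|split; [apply (H (0, 1)%nat)|split;
  [apply (H (2, 0)%nat)|split; [apply (H (1, 1)%nat)|apply (H (0, 2)%nat)]]]]]; simpl; tauto.
Qed.

Lemma is_jet_zero : is_jet (fun _ => jzero).
Proof.
split.
- intros a b. simpl. split_jet; apply (is_derive_const (K := R_AbsRing) (V := R_NormedModule)).
- intros alpha _ p. apply continuous_const.
Qed.

Lemma is_jet_add F G : is_jet F -> is_jet G -> is_jet (fun q => jadd (F q) (G q)).
Proof.
intros [HF CF] [HG CG]. split.
- intros a b. destruct (HF a b) as ((? & ?) & (? & ?) & (? & ?)).
  destruct (HG a b) as ((? & ?) & (? & ?) & (? & ?)). simpl.
  split_jet; apply is_derive_Rplus; auto.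
- apply (mindices2_ind (fun alpha => forall p, continuous (fun q => jcomp alpha (jadd (F q) (G q))) p));
    intros p; destruct (continuous_jcomp F CF p) as (? & ? & ? & ? & ? & ?);
    destruct (continuous_jcomp G CG p) as (? & ? & ? & ? & ? & ?); simpl;
    apply continuous_Rplus; auto.
Qed.

Lemma is_jet_sub F G : is_jet F -> is_jet G -> is_jet (fun q => jsub (F q) (G q)).
Proof.
intros [HF CF] [HG CG]. split.
- intros a b. destruct (HF a b) as ((? & ?) & (? & ?) & (? & ?)).
  destruct (HG a b) as ((? & ?) & (? & ?) & (? & ?)). simpl.
  split_jet; apply is_derive_Rminus; auto.
- apply (mindices2_ind (fun alpha => forall p, continuous (fun q => jcomp alpha (jsub (F q) (G q))) p));
    intros p; destruct (continuous_jcomp F CF p) as (? & ? & ? & ? & ? & ?);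
    destruct (continuous_jcomp G CG p) as (? & ? & ? & ? & ? & ?); simpl;
    apply continuous_Rminus; auto.
Qed.

Lemma is_jet_mul F G : is_jet F -> is_jet G -> is_jet (fun q => jmul (F q) (G q)).
Proof.
intros [HF CF] [HG CG]. split.
- intros a b. destruct (HF a b) as ((? & ?) & (? & ?) & (? & ?)).
  destruct (HG a b) as ((? & ?) & (? & ?) & (? & ?)). simpl.
  split_jet; (eapply is_derive_eq;
    [derive_rules | simpl; ring]).
- apply (mindices2_ind (fun alpha => forall p, continuous (fun q => jcomp alpha (jmul (F q) (G q))) p));
    intros p; destruct (continuous_jcomp F CF p) as (? & ? & ? & ? & ? & ?);
    destruct (continuous_jcomp G CG p) as (? & ? & ? & ? & ? & ?); simpl;
    repeat first [assumption | apply continuous_const | apply continuous_Rplus | apply continuous_Rmult].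
Qed.

(** * Cutoffs of one variable and their tensor products *)

Definition C2_data (b b1 b2 : R -> R) : Prop :=
  (forall t, is_derive b t (b1 t)) /\ (forall t, is_derive b1 t (b2 t)) /\ (forall t, continuous b2 t).

Definition jtensor (b b1 b2 c c1 c2 : R -> R) (p : R * R) : jet :=
  let (x, y) := p in Jet (b x * c y) (b1 x * c y) (b x * c1 y) (b2 x * c y) (b1 x * c1 y) (b x * c2 y).

Lemma C2_data_continuous b b1 b2 : C2_data b b1 b2 ->
  (forall t, continuous b t) /\ (forall t, continuous b1 t) /\ (forall t, continuous b2 t).
Proof.
intros (H0 & H1 & H2). repeat split; auto; intros t;
  apply (ex_derive_continuous (K := R_AbsRing) (V := R_NormedModule)); eexists; auto.
Qed.

Lemma is_jet_tensor b b1 b2 c c1 c2 : C2_data b b1 b2 -> C2_data c c1 c2 ->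
  is_jet (jtensor b b1 b2 c c1 c2).
Proof.
intros HB HC. split.
- destruct HB as (B0 & B1 & _). destruct HC as (C0 & C1 & _).
  intros x y. unfold jtensor. simpl.
  split_jet.
  + apply (is_derive_Rscal_r b (c y) x (b1 x)), B0.
  + apply (is_derive_Rscal c (b x) y (c1 y)), C0.
  + apply (is_derive_Rscal_r b1 (c y) x (b2 x)), B1.
  + apply (is_derive_Rscal c (b1 x) y (c1 y)), C0.
  + apply (is_derive_Rscal_r b (c1 y) x (b1 x)), B0.
  + apply (is_derive_Rscal c1 (b x) y (c2 y)), C1.
- destruct (C2_data_continuous b b1 b2 HB) as (B0 & B1 & B2).
  destruct (C2_data_continuous c c1 c2 HC) as (C0 & C1 & C2).
  assert (HX : forall h : R -> R, (forall t, continuous h t) -> forall p : R * R, continuous (fun q : R * R => h (fst q)) p).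
  { intros h Hh p. apply (continuous_comp fst h). apply continuous_fst. apply Hh. }
  assert (HY : forall h : R -> R, (forall t, continuous h t) -> forall p : R * R, continuous (fun q : R * R => h (snd q)) p).
  { intros h Hh p. apply (continuous_comp snd h). apply continuous_snd. apply Hh. }
  assert (HXY : forall h k : R -> R, (forall t, continuous h t) -> (forall t, continuous k t) ->
     forall p : R * R, continuous (fun q : R * R => h (fst q) * k (snd q)) p).
  { intros h k Hh Hk p. apply continuous_Rmult; auto. }
  apply (mindices2_ind (fun alpha => forall p, continuous (fun q => jcomp alpha (jtensor b b1 b2 c c1 c2 q)) p));
   intros p;
   [ apply (continuous_ext (fun q : R * R => b (fst q) * c (snd q)))
   | apply (continuous_ext (fun q : R * R => b1 (fst q) * c (snd q)))
   | apply (continuous_ext (fun q : R * R => b (fst q) * c1 (snd q)))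
   | apply (continuous_ext (fun q : R * R => b2 (fst q) * c (snd q)))
   | apply (continuous_ext (fun q : R * R => b1 (fst q) * c1 (snd q)))
   | apply (continuous_ext (fun q : R * R => b (fst q) * c2 (snd q))) ];
   first [now apply HXY | now intros [u w]].
Qed.

Lemma C2_data_affine b b1 b2 k m : C2_data b b1 b2 ->
  C2_data (fun t => b (k * (t - m))) (fun t => k * b1 (k * (t - m))) (fun t => k * (k * b2 (k * (t - m)))).
Proof.
intros H. pose proof (C2_data_continuous _ _ _ H) as (_ & _ & C2). destruct H as (H0 & H1 & H2).
assert (HD : forall (h h1 : R -> R) t, (forall u, is_derive h u (h1 u)) ->
  is_derive (fun t => h (k * (t - m))) t (k * h1 (k * (t - m)))).
{ intros h h1 t Hh. eapply is_derive_eq.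
  - apply (is_derive_comp (K := R_AbsRing) (V := R_NormedModule) h (fun t => k * (t - m)) t).
    + apply Hh.
    + apply is_derive_Rscal. apply is_derive_Rminus.
      apply (is_derive_id (K := R_AbsRing)). apply (is_derive_const (K := R_AbsRing) (V := R_NormedModule)).
  - unfold scal, one, zero; simpl. unfold mult; simpl. ring. }
split; [|split]; intros t.
- now apply HD.
- apply is_derive_Rscal. now apply HD.
- repeat apply (continuous_mult (K := R_AbsRing)); try apply continuous_const.
  apply (continuous_comp (fun t => k * (t - m)) b2); auto.
  apply (ex_derive_continuous (K := R_AbsRing) (V := R_NormedModule)). auto_derive. auto.
Qed.

(** Off 0 the truncated power is a polynomial. At 0 its exponent is at least 2, so the difference
    quotient is bounded by a positive power of [|h|]. *)
Lemma is_derive_cube_pos t : is_derive (fun t => Rmax t 0 ^ 3) t (3 * Rmax t 0 ^ 2) /\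
  is_derive (fun t => Rmax t 0 ^ 2) t (2 * Rmax t 0).
Proof.
assert (HP : forall n, 0 < t -> is_derive (fun t => Rmax t 0 ^ S n) t (INR (S n) * Rmax t 0 ^ n)).
{ intros n Ht. apply (is_derive_ext_loc (fun t => t ^ S n)).
  - exists (mkposreal t Ht). intros y Hy. apply Rabs_lt_between' in Hy. simpl in Hy.
    rewrite Rmax_left by lra. auto.
  - rewrite Rmax_left by lra. eapply is_derive_eq; [apply is_derive_pow, (is_derive_id (K := R_AbsRing))|].
    unfold one; simpl. ring. }
assert (HN : forall n, t < 0 -> is_derive (fun t => Rmax t 0 ^ S n) t 0).
{ intros n Ht. apply (is_derive_ext_loc (fun t => 0)).
  - exists (mkposreal (- t) ltac:(lra)). intros y Hy. apply Rabs_lt_between' in Hy. simpl in Hy.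
    rewrite Rmax_right by lra. simpl. ring.
  - apply (is_derive_const (K := R_AbsRing) (V := R_NormedModule)). }
assert (H0 : forall n, is_derive (fun t => Rmax t 0 ^ S (S n)) 0 0).
{ intros n. apply is_derive_Reals. intros eps Heps.
  exists (mkposreal (Rmin 1 eps) ltac:(apply Rmin_glb_lt; lra)). intros h Hh Hd. simpl in Hd.
  rewrite Rplus_0_l, (Rmax_left 0 0), pow_i by (lra || lia).
  replace ((Rmax h 0 ^ S (S n) - 0) / h - 0) with (Rmax h 0 ^ S n * (Rmax h 0 / h)).
  2:{ simpl. field. auto. }
  pose proof (Rmin_l 1 eps). pose proof (Rmin_r 1 eps).
  assert (Hm : 0 <= Rmax h 0 <= Rabs h) by (unfold Rmax; destruct Rle_dec; split_Rabs; lra).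
  assert (Hq : Rabs (Rmax h 0 / h) <= 1).
  { rewrite Rabs_div by auto. apply Rle_div_l. now apply Rabs_pos_lt. rewrite Rabs_right; lra. }
  rewrite Rabs_mult. apply Rle_lt_trans with (Rabs (Rmax h 0 ^ S n) * 1).
  { apply Rmult_le_compat_l; auto. apply Rabs_pos. }
  rewrite Rmult_1_r, Rabs_right by (apply Rle_ge, pow_le; lra).
  assert (Hpw : Rmax h 0 ^ n <= 1).
  { rewrite <- (pow1 n). apply pow_incr. lra. }
  pose proof (pow_le (Rmax h 0) n (proj1 Hm)). simpl. nra. }
destruct (Rtotal_order t 0) as [Ht|[Ht|Ht]].
- rewrite (Rmax_right t 0) by lra. split; (eapply is_derive_eq; [now apply HN|ring]).
- subst t. rewrite (Rmax_left 0 0) by lra. split; (eapply is_derive_eq; [apply H0|ring]).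
- split; (eapply is_derive_eq; [now apply HP|simpl; ring]).
Qed.

(* The integral of the quadratic B-spline, written with truncated cubes. *)
Lemma step_exists : exists (a a1 a2 : R -> R) (B : R), C2_data a a1 a2 /\
  (forall t, 0 <= a t <= 1 /\ Rabs (a1 t) <= B /\ Rabs (a2 t) <= B) /\
  (forall t, t <= 0 -> a t = 0 /\ a1 t = 0 /\ a2 t = 0) /\
  (forall t, 3 <= t -> a t = 1 /\ a1 t = 0 /\ a2 t = 0).
Proof.
set (m := fun t : R => Rmax t 0).
exists (fun t => / 6 * (m t ^ 3 - 3 * m (t - 1) ^ 3 + 3 * m (t - 2) ^ 3 - m (t - 3) ^ 3)),
  (fun t => / 2 * (m t ^ 2 - 3 * m (t - 1) ^ 2 + 3 * m (t - 2) ^ 2 - m (t - 3) ^ 2)),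
  (fun t => m t - 3 * m (t - 1) + 3 * m (t - 2) - m (t - 3)), 1.
assert (HS : forall (h h1 : R -> R) k t, (forall u, is_derive h u (h1 u)) ->
  is_derive (fun t => h (t - k)) t (h1 (t - k))).
{ intros h h1 k t Hh. eapply is_derive_eq.
  - apply (is_derive_comp (K := R_AbsRing) (V := R_NormedModule) h (fun t => t - k) t); [apply Hh|].
    apply is_derive_Rminus. apply (is_derive_id (K := R_AbsRing)).
    apply (is_derive_const (K := R_AbsRing) (V := R_NormedModule)).
  - unfold scal, one, zero; simpl. unfold mult; simpl. ring. }
split; [|split; [|split]].
- split; [|split]; intros t.
  + eapply is_derive_eq.
    * apply is_derive_Rscal. apply is_derive_Rminus; [apply is_derive_Rplus; [apply is_derive_Rminus|]|].
      1: apply is_derive_cube_pos.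
      1, 2: apply is_derive_Rscal.
      all: apply (HS (fun u => m u ^ 3) (fun u => 3 * m u ^ 2)); apply is_derive_cube_pos.
    * unfold m. field.
  + eapply is_derive_eq.
    * apply is_derive_Rscal. apply is_derive_Rminus; [apply is_derive_Rplus; [apply is_derive_Rminus|]|].
      1: apply is_derive_cube_pos.
      1, 2: apply is_derive_Rscal.
      all: apply (HS (fun u => m u ^ 2) (fun u => 2 * m u)); apply is_derive_cube_pos.
    * unfold m. field.
  + assert (HC : forall k, continuous (fun t => m (t - k)) t).
    { intros k. apply (continuous_ext (fun t => (Rabs (t - k) + (t - k)) / 2)).
      - intros u. unfold m, Rmax. destruct Rle_dec; split_Rabs; lra.
      - apply (continuous_mult (K := R_AbsRing)); [|apply continuous_const].
        assert (Hk : continuous (fun t : R => t - k) t).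
        { apply (ex_derive_continuous (K := R_AbsRing) (V := R_NormedModule)). auto_derive. auto. }
        apply (continuous_plus (K := R_AbsRing) (V := R_NormedModule)); auto.
        apply (continuous_comp (fun t => t - k) Rabs); auto. apply continuous_Rabs. }
    apply (continuous_ext (fun t => m (t - 0) - 3 * m (t - 1) + 3 * m (t - 2) - m (t - 3))).
    { intros u. now rewrite Rminus_0_r. }
    apply (continuous_minus (K := R_AbsRing) (V := R_NormedModule)); auto.
    apply (continuous_plus (K := R_AbsRing) (V := R_NormedModule)); auto.
    apply (continuous_minus (K := R_AbsRing) (V := R_NormedModule)); auto.
    all: apply (continuous_mult (K := R_AbsRing)); auto; apply continuous_const.
- assert (Hl : forall u, u <= 0 -> m u = 0) by (intros; apply Rmax_right; lra).
  assert (Hr : forall u, 0 <= u -> m u = u) by (intros; apply Rmax_left; lra).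
  intros t. rewrite !Rabs_le_between.
  destruct (Rle_dec t 0); [rewrite !Hl by lra; lra|].
  destruct (Rle_dec t 1); [rewrite (Hr t), !Hl by lra|
  destruct (Rle_dec t 2); [rewrite (Hr t), (Hr (t - 1)), !Hl by lra|
  destruct (Rle_dec t 3); [rewrite (Hr t), (Hr (t - 1)), (Hr (t - 2)), !Hl by lra|
  rewrite !Hr by lra]]].
  + assert (0 <= t ^ 2 <= 1) by nra. assert (0 <= t ^ 3 <= 1) by nra. lra.
  + set (u := t - 1). replace t with (u + 1) by (unfold u; ring).
    assert (0 <= u <= 1) by (unfold u; lra).
    assert (0 <= u ^ 2 <= 1) by nra. assert (0 <= u ^ 3 <= u ^ 2) by nra. nra.
  + set (u := 3 - t). replace (t - 2) with (1 - u) by (unfold u; ring).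
    replace (t - 1) with (2 - u) by (unfold u; ring). replace t with (3 - u) by (unfold u; ring).
    assert (0 <= u <= 1) by (unfold u; lra).
    assert (0 <= u ^ 2 <= 1) by nra. assert (0 <= u ^ 3 <= u ^ 2) by nra. nra.
  + repeat split; ring_simplify; lra.
- intros t Ht. unfold m. rewrite !Rmax_right by lra. repeat split; field.
- intros t Ht. unfold m. rewrite !Rmax_left by lra. repeat split; field.
Qed.

(** A step rising on [[-2, -1]] plus a step falling on [[1, 2]], minus 1; at every point one of the
    two steps equals 1. Rescaling by 3 gives second derivatives a factor 9 each, hence [18 * B]. *)
Lemma bump_exists : exists (b b1 b2 : R -> R) (B : R), C2_data b b1 b2 /\
  (forall t, 0 <= b t <= 1 /\ Rabs (b1 t) <= B /\ Rabs (b2 t) <= B) /\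
  (forall t, Rabs t <= 1 -> b t = 1 /\ b1 t = 0 /\ b2 t = 0) /\
  (forall t, 2 <= Rabs t -> b t = 0 /\ b1 t = 0 /\ b2 t = 0).
Proof.
destruct step_exists as (a & a1 & a2 & B & Ha & HB & H0 & H3).
pose proof (C2_data_affine a a1 a2 3 (-2) Ha) as Hp.
pose proof (C2_data_affine a a1 a2 (-3) 2 Ha) as Hm.
set (p := fun t : R => 3 * (t - -2)) in *. set (q := fun t : R => -3 * (t - 2)) in *.
exists (fun t => a (p t) + a (q t) - 1), (fun t => 3 * a1 (p t) + -3 * a1 (q t)),
  (fun t => 3 * (3 * a2 (p t)) + -3 * (-3 * a2 (q t))), (18 * B).
destruct Hp as (P0 & P1 & P2). destruct Hm as (M0 & M1 & M2).
assert (Hq1 : forall t, t <= 1 -> a (q t) = 1 /\ a1 (q t) = 0 /\ a2 (q t) = 0).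
{ intros t Ht. apply H3. unfold q. lra. }
assert (Hp1 : forall t, -1 <= t -> a (p t) = 1 /\ a1 (p t) = 0 /\ a2 (p t) = 0).
{ intros t Ht. apply H3. unfold p. lra. }
split; [|split; [|split]].
- split; [|split]; intros t.
  + eapply is_derive_eq; [apply is_derive_Rminus;
      [apply is_derive_Rplus; [apply P0|apply M0]|apply (is_derive_const (K := R_AbsRing) (V := R_NormedModule))]|].
    unfold zero, p, q; simpl. ring.
  + apply is_derive_Rplus; auto.
  + apply (continuous_plus (K := R_AbsRing) (V := R_NormedModule)); auto.
- intros t. destruct (HB (p t)) as (A0 & A1 & A2). destruct (HB (q t)) as (B0 & B1 & B2).
  split; [|split; split_Rabs; lra].
  destruct (Rle_dec t 1) as [Ht|Ht].
  + destruct (Hq1 t Ht) as (-> & _ & _). lra.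
  + destruct (Hp1 t ltac:(lra)) as (-> & _ & _). lra.
- intros t Ht. apply Rabs_le_between in Ht.
  destruct (Hq1 t ltac:(lra)) as (-> & -> & ->). destruct (Hp1 t ltac:(lra)) as (-> & -> & ->).
  repeat split; ring.
- intros t Ht. destruct (Rle_dec 0 t) as [Hs|Hs].
  + destruct (Hp1 t ltac:(lra)) as (-> & -> & ->).
    destruct (H0 (q t)) as (-> & -> & ->). { unfold q. split_Rabs; lra. } repeat split; ring.
  + destruct (Hq1 t ltac:(lra)) as (-> & -> & ->).
    destruct (H0 (p t)) as (-> & -> & ->). { unfold p. split_Rabs; lra. } repeat split; ring.
Qed.

(** * Weighted jet bounds and blending of jets *)

Definition jbound (r B : R) (j : jet) : Prop :=
  Rabs (j0 j) <= B * r ^ 2 /\ Rabs (jx j) <= B * r /\ Rabs (jy j) <= B * r /\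
  Rabs (jxx j) <= B /\ Rabs (jxy j) <= B /\ Rabs (jyy j) <= B.

(** The size of a cutoff with transition width [r], while [jbound r] is that of a function small to
    second order at scale [r]. Multiplication by the former preserves the latter. *)
Definition jcut (r b : R) (j : jet) : Prop :=
  Rabs (j0 j) <= b /\ Rabs (jx j) * r <= b /\ Rabs (jy j) * r <= b /\
  Rabs (jxx j) * r ^ 2 <= b /\ Rabs (jxy j) * r ^ 2 <= b /\ Rabs (jyy j) * r ^ 2 <= b.

Lemma jbound_add r B B' i j : jbound r B i -> jbound r B' j -> jbound r (B + B') (jadd i j).
Proof.
intros (H1 & H2 & H3 & H4 & H5 & H6) (G1 & G2 & G3 & G4 & G5 & G6).
repeat split; simpl; (eapply Rle_trans; [apply Rabs_triang|]; lra).
Qed.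

Lemma jbound_sub r B B' i j : jbound r B i -> jbound r B' j -> jbound r (B + B') (jsub i j).
Proof.
intros (H1 & H2 & H3 & H4 & H5 & H6) (G1 & G2 & G3 & G4 & G5 & G6).
repeat split; simpl; unfold Rminus; (eapply Rle_trans; [apply Rabs_triang|]; rewrite Rabs_Ropp; lra).
Qed.

Lemma jbound_mono r B B' j : 0 <= r -> B <= B' -> jbound r B j -> jbound r B' j.
Proof.
intros Hr HB (H1 & H2 & H3 & H4 & H5 & H6). pose proof (pow_le r 2 Hr).
assert (B * r <= B' * r) by (apply Rmult_le_compat_r; auto).
assert (B * r ^ 2 <= B' * r ^ 2) by (apply Rmult_le_compat_r; auto).
repeat split; lra.
Qed.

Lemma jbound_zero r B : 0 <= r -> 0 <= B -> jbound r B jzero.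
Proof.
intros Hr HB. pose proof (pow_le r 2 Hr).
repeat split; simpl; rewrite Rabs_R0; auto; apply Rmult_le_pos; auto.
Qed.

(** In Leibniz's rule each power of [r] lost by the cutoff is regained from [j]; a second derivative
    has four terms, counted with multiplicity. *)
Lemma jbound_mul r b B i j : 0 < r -> jcut r b i -> jbound r B j -> jbound r (4 * b * B) (jmul i j).
Proof.
intros Hr (H1 & H2 & H3 & H4 & H5 & H6) (G1 & G2 & G3 & G4 & G5 & G6).
pose proof (Rabs_pos (j0 i)). pose proof (Rabs_pos (jxx j)).
assert (Hb : 0 <= b) by lra. assert (HB : 0 <= B) by lra.
assert (Hr2 : 0 < r ^ 2) by (apply pow_lt; auto).
assert (HbB : 0 <= b * B) by (apply Rmult_le_pos; auto).
assert (T : forall u v m n c, 0 < m -> Rabs u * m <= b -> Rabs v <= B * n -> n = c * m ->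
  Rabs (u * v) <= b * B * c).
{ intros u v m n c Hm Hu Hv ->. rewrite Rabs_mult.
  apply (Rmult_le_reg_r m); auto.
  replace (b * B * c * m) with (b * (B * (c * m))) by ring.
  replace (Rabs u * Rabs v * m) with (Rabs u * m * Rabs v) by ring.
  apply Rmult_le_compat; auto using Rabs_pos. apply Rmult_le_pos; [apply Rabs_pos|lra]. }
assert (H1' : Rabs (j0 i) * 1 <= b) by lra.
assert (G4' : Rabs (jxx j) <= B * 1) by lra. assert (G5' : Rabs (jxy j) <= B * 1) by lra.
assert (G6' : Rabs (jyy j) <= B * 1) by lra.
assert (Hr0 : 0 <= b * B * r) by (apply Rmult_le_pos; lra).
assert (Hr20 : 0 <= b * B * r ^ 2) by (apply Rmult_le_pos; lra).
repeat split; simpl.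
- pose proof (T _ _ _ _ (r ^ 2) Rlt_0_1 H1' G1 ltac:(ring)). lra.
- pose proof (T _ _ _ _ r Hr H2 G1 ltac:(ring)). pose proof (T _ _ _ _ r Rlt_0_1 H1' G2 ltac:(ring)).
  eapply Rle_trans; [apply Rabs_triang|]. lra.
- pose proof (T _ _ _ _ r Hr H3 G1 ltac:(ring)). pose proof (T _ _ _ _ r Rlt_0_1 H1' G3 ltac:(ring)).
  eapply Rle_trans; [apply Rabs_triang|]. lra.
- pose proof (T _ _ _ _ 1 Hr2 H4 G1 ltac:(ring)). pose proof (T _ _ _ _ 1 Hr H2 G2 ltac:(ring)).
  pose proof (T _ _ _ _ 1 Rlt_0_1 H1' G4' ltac:(ring)).
  replace (jxx i * j0 j + 2 * jx i * jx j + j0 i * jxx j)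
    with (jxx i * j0 j + (jx i * jx j + jx i * jx j) + j0 i * jxx j) by ring.
  eapply Rle_trans; [apply Rabs_triang|]. eapply Rle_trans; [apply Rplus_le_compat_r, Rabs_triang|].
  pose proof (Rabs_triang (jx i * jx j) (jx i * jx j)). lra.
- pose proof (T _ _ _ _ 1 Hr2 H5 G1 ltac:(ring)). pose proof (T _ _ _ _ 1 Hr H2 G3 ltac:(ring)).
  pose proof (T _ _ _ _ 1 Hr H3 G2 ltac:(ring)). pose proof (T _ _ _ _ 1 Rlt_0_1 H1' G5' ltac:(ring)).
  eapply Rle_trans; [apply Rabs_triang|]. eapply Rle_trans; [apply Rplus_le_compat_r, Rabs_triang|].
  pose proof (Rabs_triang (jxy i * j0 j) (jx i * jy j)). lra.
- pose proof (T _ _ _ _ 1 Hr2 H6 G1 ltac:(ring)). pose proof (T _ _ _ _ 1 Hr H3 G3 ltac:(ring)).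
  pose proof (T _ _ _ _ 1 Rlt_0_1 H1' G6' ltac:(ring)).
  replace (jyy i * j0 j + 2 * jy i * jy j + j0 i * jyy j)
    with (jyy i * j0 j + (jy i * jy j + jy i * jy j) + j0 i * jyy j) by ring.
  eapply Rle_trans; [apply Rabs_triang|]. eapply Rle_trans; [apply Rplus_le_compat_r, Rabs_triang|].
  pose proof (Rabs_triang (jy i * jy j) (jy i * jy j)). lra.
Qed.

(** The successive blend of [blendv] on jets; it involves only sums and products, so smoothness is
    inherited. *)
Definition blendj (Phi P : R * R -> jet) (Z : list (R * R)) : jet :=
  fold_right (fun z G => jadd G (jmul (Phi z) (jsub (P z) G))) jzero Z.

Lemma blendj_cons Phi P z Z : blendj Phi P (z :: Z) =
  jadd (blendj Phi P Z) (jmul (Phi z) (jsub (P z) (blendj Phi P Z))).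
Proof. reflexivity. Qed.

Lemma jblend_zero G P : jadd G (jmul jzero (jsub P G)) = G.
Proof. destruct G, P. unfold jadd, jsub, jmul, jzero; simpl; f_equal; ring. Qed.

Lemma jblend_one G P : jadd G (jmul jone (jsub P G)) = P.
Proof. destruct G, P. unfold jadd, jsub, jmul, jone; simpl; f_equal; ring. Qed.

Lemma is_jet_blend (Phi P : R * R -> R * R -> jet) Z : (forall z, is_jet (Phi z)) -> (forall z, is_jet (P z)) ->
  is_jet (fun y => blendj (fun z => Phi z y) (fun z => P z y) Z).
Proof.
intros HPhi HP. induction Z as [|z Z IH].
- apply is_jet_zero.
- apply (is_jet_add _ (fun y => jmul (Phi z y) (jsub (P z y) (blendj (fun z => Phi z y) (fun z => P z y) Z)))); auto.
  apply is_jet_mul; auto. now apply is_jet_sub.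
Qed.

Lemma blendj_ext Phi P P' (p : R * R -> bool) Z :
  (forall z, In z Z -> p z = false -> Phi z = jzero) ->
  (forall z, In z Z -> p z = true -> P z = P' z) -> blendj Phi P Z = blendj Phi P' Z.
Proof.
induction Z as [|z Z IH]; intros H0 H; auto. rewrite !blendj_cons.
rewrite IH by (intros; auto with datatypes).
destruct (p z) eqn:Ep.
- now rewrite (H z (or_introl eq_refl) Ep).
- now rewrite (H0 z (or_introl eq_refl) Ep), !jblend_zero.
Qed.

Lemma blendj_pos Phi P Z : (forall z, 0 <= j0 (Phi z) <= 1) -> (forall z, In z Z -> 0 <= j0 (P z)) ->
  0 <= j0 (blendj Phi P Z).
Proof.
intros HPhi. induction Z as [|z Z IH]; intros HP. { simpl; lra. }
rewrite blendj_cons. simpl. specialize (IH (fun y Hy => HP y (or_intror Hy))).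
specialize (HP z (or_introl eq_refl)). specialize (HPhi z).
set (g := j0 (blendj Phi P Z)) in *.
replace (g + j0 (Phi z) * (j0 (P z) - g)) with ((1 - j0 (Phi z)) * g + j0 (Phi z) * j0 (P z)) by ring.
apply Rplus_le_le_0_compat; apply Rmult_le_pos; lra.
Qed.

Lemma blendj_val Phi P (p : R * R -> bool) Z z0 c : In z0 Z -> Phi z0 = jone ->
  (forall z, In z Z -> p z = false -> Phi z = jzero) ->
  (forall z, In z Z -> p z = true -> j0 (P z) = c) -> p z0 = true -> j0 (blendj Phi P Z) = c.
Proof.
intros Hz0 E0. induction Z as [|z Z IH]; intros H0 H Hp. { destruct Hz0. }
rewrite blendj_cons. destruct (excluded_middle_informative (z = z0)) as [->|Hne].
- rewrite E0, jblend_one. auto with datatypes.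
- assert (IH' : j0 (blendj Phi P Z) = c).
  { apply IH; auto with datatypes. destruct Hz0; congruence. }
  destruct (p z) eqn:Ep.
  + simpl. rewrite IH', (H z (or_introl eq_refl) Ep). ring.
  + now rewrite (H0 z (or_introl eq_refl) Ep), jblend_zero.
Qed.

(** Each active centre multiplies the error against [Q] by at most [1 + 8 * b]. The induction starts
    at a centre of full weight or, when [Q = jzero], at the initial jet. *)
Lemma blendj_bound Phi P (p : R * R -> bool) Z Q r A b : 0 < r -> 0 <= A -> 0 <= b ->
  (forall z, In z Z -> p z = false -> Phi z = jzero) ->
  (forall z, In z Z -> p z = true -> jcut r b (Phi z) /\ jbound r A (jsub (P z) Q)) ->
  (Q = jzero \/ exists z, In z Z /\ p z = true /\ Phi z = jone) ->
  jbound r (A * (1 + 8 * b) ^ length (filter p Z)) (jsub (blendj Phi P Z) Q).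
Proof.
intros Hr HA Hb. induction Z as [|z Z IH]; intros H0 H HQ.
- destruct HQ as [->|(z & [] & _)]. simpl. rewrite Rmult_1_r.
  replace (jsub jzero jzero) with jzero by (unfold jsub, jzero; simpl; f_equal; ring).
  apply jbound_zero; lra.
- assert (Hpow : forall n, A <= A * (1 + 8 * b) ^ n).
  { intros n. rewrite <- (Rmult_1_r A) at 1. apply Rmult_le_compat_l; auto. apply pow_R1_Rle. lra. }
  rewrite blendj_cons. destruct (excluded_middle_informative (p z = true /\ Phi z = jone)) as [[Hp E1]|Hn].
  + rewrite E1, jblend_one.
    apply (jbound_mono r A); [lra|apply Hpow|]. apply H; auto with datatypes.
  + assert (IH' : jbound r (A * (1 + 8 * b) ^ length (filter p Z)) (jsub (blendj Phi P Z) Q)).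
    { apply IH; auto with datatypes. destruct HQ as [HQ|(z0 & [->|Hz0] & Hz1)]; auto.
      - tauto.
      - right. exists z0. auto. }
    simpl filter. destruct (p z) eqn:Ep.
    * destruct (H z (or_introl eq_refl) Ep) as [Hc HP].
      change (length (z :: filter p Z)) with (S (length (filter p Z))).
      set (G := blendj Phi P Z) in *. set (n := length (filter p Z)) in *.
      replace (jsub (jadd G (jmul (Phi z) (jsub (P z) G))) Q)
        with (jadd (jsub G Q) (jmul (Phi z) (jsub (jsub (P z) Q) (jsub G Q)))).
      2:{ unfold jadd, jsub, jmul; simpl; f_equal; ring. }
      pose proof (jbound_sub _ _ _ _ _ HP IH') as Hs.
      pose proof (jbound_add _ _ _ _ _ IH' (jbound_mul _ _ _ _ _ Hr Hc Hs)) as Hf.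
      apply (jbound_mono r _ _ _ (Rlt_le _ _ Hr)) with (2 := Hf).
      simpl. specialize (Hpow n). set (B := A * (1 + 8 * b) ^ n) in *.
      replace (A * ((1 + 8 * b) * (1 + 8 * b) ^ n)) with ((1 + 8 * b) * B) by (unfold B; ring).
      assert (4 * b * A <= 4 * b * B) by (apply Rmult_le_compat_l; lra). lra.
    * now rewrite (H0 z (or_introl eq_refl) Ep), jblend_zero.
Qed.

Lemma cutoff_exists : exists b : R, 0 <= b /\ forall s : R * R -> R, lip1 s -> (forall x, 0 < s x) ->
  exists Phi : R * R -> R * R -> jet,
  (forall z, is_jet (Phi z)) /\ (forall z y, 0 <= j0 (Phi z y) <= 1) /\
  (forall z y, pdist y z <= s z / 16 -> Phi z y = jone) /\
  (forall z y, active s y z = false -> Phi z y = jzero) /\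
  (forall z y, active s y z = true -> jcut (s y) b (Phi z y)).
Proof.
destruct bump_exists as (c & c1 & c2 & B & Hc & HB & H1 & H2).
assert (HB0 : 0 <= B). { destruct (HB 0) as (_ & H & _). pose proof (Rabs_pos (c1 0)). lra. }
exists (400 * (1 + B) ^ 2). split. { nra. }
intros s Hlip Hpos.
(* In each coordinate the bump is 1 up to [s z / 16] and 0 from [s z / 8] on; outside the active
   ball one coordinate exceeds [s z / 8]. At active points [16 / s z * s y <= 20], and
   [20 ^ 2 = 400]. *)
exists (fun z => jtensor (fun t => c (16 / s z * (t - fst z))) (fun t => 16 / s z * c1 (16 / s z * (t - fst z)))
    (fun t => 16 / s z * (16 / s z * c2 (16 / s z * (t - fst z))))
    (fun t => c (16 / s z * (t - snd z))) (fun t => 16 / s z * c1 (16 / s z * (t - snd z)))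
    (fun t => 16 / s z * (16 / s z * c2 (16 / s z * (t - snd z))))).
assert (Hk : forall z, 0 < 16 / s z) by (intros z; apply Rdiv_lt_0_compat; [lra|auto]).
assert (Hks : forall z, 16 / s z * s z = 16) by (intros z; field; apply Rgt_not_eq, Hpos).
assert (Habs : forall z t, Rabs (16 / s z * t) * s z = 16 * Rabs t).
{ intros z t. rewrite Rabs_mult, (Rabs_right (16 / s z)) by (apply Rle_ge, Rlt_le, Hk).
  rewrite <- (Hks z) at 2. ring. }
split; [|split; [|split; [|split]]].
- intros z. apply is_jet_tensor; now apply C2_data_affine.
- intros z [y1 y2]. simpl. destruct (HB (16 / s z * (y1 - fst z))) as [A1 _].
  destruct (HB (16 / s z * (y2 - snd z))) as [A2 _]. split. apply Rmult_le_pos; lra.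
  apply Rle_trans with (1 * 1); [apply Rmult_le_compat; lra|lra].
- intros z [y1 y2] Hd. unfold pdist in Hd.
  pose proof (Rabs_fst_le ((y1, y2) - z)%C) as F1. pose proof (Rabs_snd_le ((y1, y2) - z)%C) as F2.
  simpl in F1, F2. fold (y1 - fst z) in F1. fold (y2 - snd z) in F2.
  assert (HH : forall t, Rabs t <= s z / 16 -> Rabs (16 / s z * t) <= 1).
  { intros t Ht. apply (Rmult_le_reg_r (s z)); auto. rewrite Habs. lra. }
  destruct (H1 (16 / s z * (y1 - fst z))) as (E1 & E2 & E3). { apply HH. lra. }
  destruct (H1 (16 / s z * (y2 - snd z))) as (E4 & E5 & E6). { apply HH. lra. }
  simpl. rewrite E1, E2, E3, E4, E5, E6. unfold jone. f_equal; ring.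
- intros z [y1 y2] Ha. assert (Hn : ~ pdist (y1, y2) z <= s z / 4). { rewrite <- activeP. congruence. }
  apply Rnot_le_lt in Hn. unfold pdist in Hn.
  pose proof (Cmod_le_abs ((y1, y2) - z)%C) as Hm. simpl in Hm.
  fold (y1 - fst z) in Hm. fold (y2 - snd z) in Hm.
  assert (HH : forall t, s z / 8 <= Rabs t -> 2 <= Rabs (16 / s z * t)).
  { intros t Ht. apply (Rmult_le_reg_r (s z)); auto. rewrite Habs. lra. }
  simpl. destruct (Rle_dec (s z / 8) (Rabs (y1 - fst z))) as [L|L].
  + destruct (H2 _ (HH _ L)) as (E1 & E2 & E3). rewrite E1, E2, E3. unfold jzero. f_equal; ring.
  + destruct (H2 (16 / s z * (y2 - snd z))) as (E1 & E2 & E3). { apply HH. lra. }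
    rewrite E1, E2, E3. unfold jzero. f_equal; ring.
- intros z [y1 y2] Ha. apply activeP in Ha. destruct (active_scale s (y1, y2) z Hlip Ha) as [S1 _].
  set (r := s (y1, y2)) in *. assert (Hr : 0 < r) by apply Hpos.
  assert (Hkr : 0 <= 16 / s z * r <= 20).
  { split. apply Rmult_le_pos; [apply Rlt_le, Hk|lra].
    apply Rle_trans with (16 / s z * (5 / 4 * s z)); [apply Rmult_le_compat_l; [apply Rlt_le, Hk|lra]|].
    replace (16 / s z * (5 / 4 * s z)) with (5 / 4 * (16 / s z * s z)) by ring. rewrite Hks. lra. }
  simpl. set (k := 16 / s z) in *.
  destruct (HB (k * (y1 - fst z))) as (A0 & A1 & A2). destruct (HB (k * (y2 - snd z))) as (B0 & B1 & B2).
  set (u0 := c (k * (y1 - fst z))) in *. set (u1 := c1 (k * (y1 - fst z))) in *. set (u2 := c2 (k * (y1 - fst z))) in *.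
  set (w0 := c (k * (y2 - snd z))) in *. set (w1 := c1 (k * (y2 - snd z))) in *. set (w2 := c2 (k * (y2 - snd z))) in *.
  assert (U0 : Rabs u0 <= 1 + B) by (split_Rabs; lra). assert (W0 : Rabs w0 <= 1 + B) by (split_Rabs; lra).
  assert (HM : forall u w, Rabs u <= 1 + B -> Rabs w <= 1 + B -> Rabs (u * w) <= (1 + B) ^ 2).
  { intros u w Hu Hw. rewrite Rabs_mult. simpl. rewrite Rmult_1_r.
    apply Rmult_le_compat; auto using Rabs_pos. }
  assert (HP : forall m u w, 0 <= m <= 400 -> Rabs u <= 1 + B -> Rabs w <= 1 + B ->
    m * Rabs (u * w) <= 400 * (1 + B) ^ 2).
  { intros m u w Hm Hu Hw. apply Rmult_le_compat; auto using Rabs_pos; lra. }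
  assert (Hk0 : Rabs k = k) by (apply Rabs_right, Rle_ge, Rlt_le, Hk).
  assert (Hkr2 : 0 <= (k * r) ^ 2 <= 400) by nra.
  repeat split; simpl.
  + pose proof (HP 1 u0 w0 ltac:(lra) U0 W0). lra.
  + replace (k * u1 * w0) with (k * (u1 * w0)) by ring. rewrite Rabs_mult, Hk0.
    pose proof (HP (k * r) u1 w0 ltac:(lra) ltac:(lra) W0). lra.
  + replace (u0 * (k * w1)) with (k * (u0 * w1)) by ring. rewrite Rabs_mult, Hk0.
    pose proof (HP (k * r) u0 w1 ltac:(lra) U0 ltac:(lra)). lra.
  + replace (k * (k * u2) * w0) with (k * (k * (u2 * w0))) by ring. rewrite !(Rabs_mult k), Hk0.
    pose proof (HP ((k * r) ^ 2) u2 w0 Hkr2 ltac:(lra) W0). lra.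
  + replace (k * u1 * (k * w1)) with (k * (k * (u1 * w1))) by ring. rewrite !(Rabs_mult k), Hk0.
    pose proof (HP ((k * r) ^ 2) u1 w1 Hkr2 ltac:(lra) ltac:(lra)). lra.
  + replace (u0 * (k * (k * w2))) with (k * (k * (u0 * w2))) by ring. rewrite !(Rabs_mult k), Hk0.
    pose proof (HP ((k * r) ^ 2) u0 w2 Hkr2 U0 ltac:(lra)). lra.
Qed.

(** * Whitney extension of a nonnegative field *)

(** The distance to the second nearest point of [E], capped at 1: at this scale a patch has to
    interpolate at one point only. *)
Lemma pair_scale (E : list (R * R)) : exists s : R * R -> R,
  lip1 s /\ (exists m, 0 < m /\ forall x, m <= s x) /\ (forall x, s x <= 1) /\
  (forall x, s x = 1 \/ exists a, In a E /\ pdist x a <= s x) /\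
  (forall x a b, In a E -> In b E -> a <> b -> s x <= Rmax (pdist x a) (pdist x b)).
Proof.
set (L := filter (fun t : (R * R) * (R * R) => if excluded_middle_informative (fst t = snd t) then false else true)
           (list_prod E E)).
assert (HL : forall a b, In (a, b) L <-> (In a E /\ In b E /\ a <> b)).
{ intros a b. unfold L. rewrite filter_In, in_prod_iff. simpl.
  destruct excluded_middle_informative; intuition discriminate. }
destruct (scale_exists L (fun t x => Rmax (pdist x (fst t)) (pdist x (snd t)))) as (s & H1 & H2 & H3 & H4 & H5).
- intros t _. apply lip1_max; apply lip1_pdist.
- intros [a b] Ht. apply HL in Ht. destruct Ht as (_ & _ & Hne). apply pdist_gt_0 in Hne.
  exists (pdist a b / 2). split; [lra|]. intros x. simpl.
  pose proof (pdist_tri x a b). rewrite (pdist_sym a x) in *. unfold Rmax. destruct Rle_dec; lra.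
- exists s. split; auto. split; auto. split; auto. split.
  + intros x. destruct (H5 x) as [E1|([a b] & Hin & Hh)]; auto. right.
    apply HL in Hin. exists a. split; [tauto|]. rewrite <- Hh. apply Rmax_l.
  + intros x a b Ha Hb Hne. apply (H4 x (a, b)). apply HL. auto.
Qed.

(** Nets are drawn from finite lists, whereas the cutoffs must cover a region of the plane around
    [E]; a grid finer than the least scale bridges the gap. *)
Lemma grid_exists (E : list (R * R)) (eta : R) : 0 < eta -> exists L : list (R * R),
  incl E L /\ (forall p, In p L -> exists a, In a E /\ pdist p a <= 2) /\
  (forall y a, In a E -> pdist y a <= 1 -> exists p, In p L /\ pdist y p <= eta).
Proof.
intros Heta.
destruct (nfloor_ex (2 / eta)) as [n0 Hn0]. { apply Rlt_le, Rdiv_lt_0_compat; lra. }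
set (n := S n0).
assert (Hn : 0 < INR n) by (apply lt_0_INR; unfold n; lia).
assert (Hn1 : / INR n <= eta / 2).
{ apply (Rmult_le_reg_r (INR n)); auto. rewrite Rinv_l by lra.
  assert (2 / eta * eta <= INR n * eta). { apply Rmult_le_compat_r; [lra|]. unfold n. rewrite S_INR. lra. }
  replace (2 / eta * eta) with 2 in H by (field; lra). lra. }
clearbody n. clear n0 Hn0.
set (co := fun i : nat => (INR i - INR n) / INR n).
set (I := list_prod (seq 0 (2 * n + 1)) (seq 0 (2 * n + 1))).
exists (flat_map (fun a => map (fun ij : nat * nat => (fst a + co (fst ij), snd a + co (snd ij))) I) E).
assert (Hco : forall i, In i (seq 0 (2 * n + 1)) -> Rabs (co i) <= 1).
{ intros i Hi. apply in_seq in Hi. unfold co.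
  rewrite Rabs_div, (Rabs_right (INR n)) by lra. apply Rle_div_l; auto.
  assert (INR i <= INR (2 * n)) by (apply le_INR; lia). rewrite mult_INR in H. simpl in H.
  pose proof (pos_INR i). apply Rabs_le_between. lra. }
assert (Hin : forall a i j, In a E -> In i (seq 0 (2 * n + 1)) -> In j (seq 0 (2 * n + 1)) ->
  In (fst a + co i, snd a + co j) (flat_map (fun a => map (fun ij : nat * nat => (fst a + co (fst ij), snd a + co (snd ij))) I) E)).
{ intros a i j Ha Hi Hj. apply in_flat_map. exists a. split; auto. apply in_map_iff.
  exists (i, j). split; auto. apply in_prod; auto. }
split; [|split].
- intros a Ha. replace a with (fst a + co n, snd a + co n).
  + apply Hin; auto; apply in_seq; lia.
  + unfold co. rewrite Rminus_diag. unfold Rdiv. rewrite !Rmult_0_l, !Rplus_0_r. now destruct a.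
- intros p Hp. apply in_flat_map in Hp. destruct Hp as (a & Ha & Hp).
  apply in_map_iff in Hp. destruct Hp as ([i j] & <- & Hij). apply in_prod_iff in Hij.
  exists a. split; auto. unfold pdist. eapply Rle_trans; [apply Cmod_le_abs|]. simpl.
  replace (fst a + co i + - fst a) with (co i) by ring.
  replace (snd a + co j + - snd a) with (co j) by ring.
  pose proof (Hco i (proj1 Hij)). pose proof (Hco j (proj2 Hij)). lra.
- intros y a Ha Hy.
  assert (HF : forall t, Rabs t <= 1 -> exists i, In i (seq 0 (2 * n + 1)) /\ Rabs (t - co i) <= eta / 2).
  { intros t Ht. apply Rabs_le_between in Ht.
    destruct (nfloor_ex ((t + 1) * INR n)) as [i Hi]. { apply Rmult_le_pos; lra. }
    exists i. split.
    - apply in_seq. split; [lia|]. assert (INR i < INR (2 * n + 1)).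
      { rewrite plus_INR, mult_INR. simpl.
        assert ((t + 1) * INR n <= 2 * INR n) by (apply Rmult_le_compat_r; lra). lra. }
      apply INR_lt in H. lia.
    - eapply Rle_trans; [|exact Hn1]. unfold co.
      replace (t - (INR i - INR n) / INR n) with (((t + 1) * INR n - INR i) * / INR n) by (field; lra).
      assert (0 < / INR n) by (now apply Rinv_0_lt_compat).
      rewrite Rabs_mult, (Rabs_right (/ INR n)) by lra.
      rewrite <- (Rmult_1_l (/ INR n)) at 2. apply Rmult_le_compat_r; [lra|].
      apply Rabs_le_between. lra. }
  unfold pdist in Hy.
  pose proof (Rabs_fst_le (y - a)%C) as F1. pose proof (Rabs_snd_le (y - a)%C) as F2. simpl in F1, F2.
  destruct (HF (fst y + - fst a) ltac:(lra)) as (i & Hi & Di).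
  destruct (HF (snd y + - snd a) ltac:(lra)) as (j & Hj & Dj).
  exists (fst a + co i, snd a + co j). split; [auto|].
  unfold pdist. eapply Rle_trans; [apply Cmod_le_abs|]. simpl.
  replace (fst y + - (fst a + co i)) with (fst y + - fst a - co i) by ring.
  replace (snd y + - (snd a + co j)) with (snd y + - snd a - co j) by ring. lra.
Qed.

(** The added quadratic keeps the first order jet at [x] and, under the discriminant condition,
    makes the patch nonnegative on the whole plane. *)
Definition patch (K c : R) (w x y : R * R) : jet :=
  Jet (c + dot w (y - x)%C + K * Cmod (y - x)%C ^ 2)
    (fst w + 2 * K * (fst y - fst x)) (snd w + 2 * K * (snd y - snd x)) (2 * K) 0 (2 * K).

Lemma is_jet_patch K c w x : is_jet (patch K c w x).
Proof.
split.
- assert (HQ : forall c0 c1 c2 m u : R, is_derive (fun t : R => c0 + c1 * (t - m) + c2 * (t - m) ^ 2) u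
    (c1 + 2 * c2 * (u - m))).
  { intros. auto_derive; auto. ring. }
  assert (HL : forall c0 c1 m u : R, is_derive (fun t : R => c0 + c1 * (t - m)) u c1).
  { intros. auto_derive; auto. ring. }
  intros a b. unfold patch. cbn [j0 jx jy jxx jxy jyy fst snd]. split_jet.
  + apply (is_derive_ext (fun t => (c + snd w * (b - snd x) + K * (b - snd x) ^ 2) + fst w * (t - fst x) + K * (t - fst x) ^ 2)); [|apply HQ].
    intros t; rewrite Cmod_sqr; unfold dot; simpl; ring.
  + apply (is_derive_ext (fun t => (c + fst w * (a - fst x) + K * (a - fst x) ^ 2) + snd w * (t - snd x) + K * (t - snd x) ^ 2)); [|apply HQ].
    intros t; rewrite Cmod_sqr; unfold dot; simpl; ring.
  + apply HL.
  + apply (is_derive_const (K := R_AbsRing) (V := R_NormedModule)).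
  + apply (is_derive_const (K := R_AbsRing) (V := R_NormedModule)).
  + apply HL.
- assert (Hf : forall p : R * R, continuous (fun q : R * R => fst q - fst x) p).
  { intros p. apply continuous_Rminus; [apply continuous_fst|apply continuous_const]. }
  assert (Hs : forall p : R * R, continuous (fun q : R * R => snd q - snd x) p).
  { intros p. apply continuous_Rminus; [apply continuous_snd|apply continuous_const]. }
  apply (mindices2_ind (fun alpha => forall p, continuous (fun q => jcomp alpha (patch K c w x q)) p)); intros p;
    unfold patch; cbn [jcomp j0 jx jy jxx jxy jyy].
  + apply (continuous_ext (fun q : R * R => c + (fst w * (fst q - fst x) + snd w * (snd q - snd x))
      + K * ((fst q - fst x) * (fst q - fst x) + (snd q - snd x) * (snd q - snd x)))).
    { intros q. rewrite Cmod_sqr. unfold dot; simpl. ring. }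
    repeat first [apply Hf | apply Hs | apply continuous_const | apply continuous_Rplus | apply continuous_Rmult].
  + repeat first [apply Hf | apply continuous_const | apply continuous_Rplus | apply continuous_Rmult].
  + repeat first [apply Hs | apply continuous_const | apply continuous_Rplus | apply continuous_Rmult].
  + apply continuous_const.
  + apply continuous_const.
  + apply continuous_const.
Qed.

Lemma patch_pos K c w x y : 0 < K -> Cmod w ^ 2 <= 4 * K * c -> 0 <= j0 (patch K c w x y).
Proof.
intros HK Hw. simpl. pose proof (dot_le w (y - x)%C) as Hd. apply Rabs_le_between in Hd.
set (d := Cmod (y - x)%C) in *. apply (Rmult_le_reg_l (4 * K)); [lra|].
pose proof (pow2_ge_0 (Cmod w - 2 * K * d)). nra.
Qed.

Lemma patch_bound K c w x y : 0 < K -> 0 <= c <= K -> Cmod w <= 2 * K -> pdist y x <= 5 ->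
  Rabs (j0 (patch K c w x y)) <= 36 * K /\ Rabs (jx (patch K c w x y)) <= 12 * K /\
  Rabs (jy (patch K c w x y)) <= 12 * K.
Proof.
intros HK Hc Hw Hd. unfold pdist in Hd. simpl.
pose proof (dot_le w (y - x)%C) as Hdot.
pose proof (Rabs_fst_le (y - x)%C) as F1. pose proof (Rabs_snd_le (y - x)%C) as F2. simpl in F1, F2.
fold (fst y - fst x) in F1. fold (snd y - snd x) in F2.
pose proof (Rabs_fst_le w). pose proof (Rabs_snd_le w).
pose proof (Cmod_ge_0 (y - x)%C) as Hd0. set (d := Cmod (y - x)%C) in *.
assert (Cmod w * d <= 2 * K * 5) by (apply Rmult_le_compat; auto; apply Cmod_ge_0).
assert (HK2 : 0 <= K * d ^ 2 <= K * 25). { split; [apply Rmult_le_pos|apply Rmult_le_compat_l]; nra. }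
assert (HL : forall t, Rabs t <= d -> Rabs (2 * K * t) <= 10 * K).
{ intros t Ht. rewrite Rabs_mult, (Rabs_right (2 * K)) by lra. nra. }
pose proof (HL _ F1). pose proof (HL _ F2).
split; [|split].
- apply Rabs_le_between in Hdot. apply Rabs_le_between. lra.
- eapply Rle_trans; [apply Rabs_triang|]. lra.
- eapply Rle_trans; [apply Rabs_triang|]. lra.
Qed.

(** The second derivatives cancel, so the difference is affine in [y]; Whitney's conditions at
    distance at most [6 * r] bound its value and gradient. *)
Lemma patch_diff K f v E x x' y r : 0 < K -> whitney_field K E f v -> In x E -> In x' E -> 0 <= r ->
  pdist y x <= 3 * r -> pdist y x' <= 3 * r ->
  jbound r (100 * K) (jsub (patch K (f x) (v x) x y) (patch K (f x') (v x') x' y)).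
Proof.
intros HK HW Hx Hx' Hr D1 D2.
assert (D3 : pdist x' x <= 6 * r).
{ pose proof (pdist_tri y x' x). rewrite (pdist_sym x' y) in *. lra. }
pose proof (pdist_ge_0 x' x) as D30. pose proof (pdist_ge_0 y x) as D10. pose proof (pdist_ge_0 y x') as D20.
destruct (HW x' Hx') as (_ & _ & H). destruct (H x Hx) as [Hv Ht]. clear H.
assert (Hv' : Cmod (v x' - v x)%C <= 6 * (K * r)).
{ apply (Rmult_le_compat_l K) in D3; lra. }
assert (Hq : 0 <= r ^ 2) by (apply pow2_ge_0).
assert (Q1 : K * pdist x' x ^ 2 <= K * (36 * r ^ 2)) by (apply Rmult_le_compat_l; nra).
assert (Q2 : 0 <= K * pdist y x ^ 2 <= K * (9 * r ^ 2)).
{ split; [apply Rmult_le_pos|apply Rmult_le_compat_l]; nra. }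
assert (Q3 : 0 <= K * pdist y x' ^ 2 <= K * (9 * r ^ 2)).
{ split; [apply Rmult_le_pos|apply Rmult_le_compat_l]; nra. }
assert (HKr : 0 <= K * r) by (apply Rmult_le_pos; lra).
assert (HL : forall a b c d : R, Rabs (a - b) <= 6 * (K * r) -> Rabs (c - d) <= 6 * r ->
  Rabs (b + 2 * K * d - (a + 2 * K * c)) <= 100 * K * r).
{ intros a b c d H1 H2. replace (b + 2 * K * d - (a + 2 * K * c)) with (- (a - b) + 2 * K * - (c - d)) by ring.
  eapply Rle_trans; [apply Rabs_triang|]. rewrite Rabs_mult, !Rabs_Ropp, (Rabs_right (2 * K)) by lra.
  apply (Rmult_le_compat_l (2 * K)) in H2; lra. }
pose proof (Rabs_fst_le (v x' - v x)%C) as V1. pose proof (Rabs_snd_le (v x' - v x)%C) as V2.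
pose proof (Rabs_fst_le (x - x')%C) as X1. pose proof (Rabs_snd_le (x - x')%C) as X2.
change (Cmod (x - x')%C) with (pdist x x') in X1, X2. rewrite (pdist_sym x x') in X1, X2.
simpl in V1, V2, X1, X2.
repeat split; unfold patch, jsub; cbn [j0 jx jy jxx jxy jyy]; try (rewrite Rminus_diag, Rabs_R0; lra).
- change (Cmod (y - x)%C) with (pdist y x). change (Cmod (y - x')%C) with (pdist y x').
  replace (f x + dot (v x) (y - x)%C + K * pdist y x ^ 2 - (f x' + dot (v x') (y - x')%C + K * pdist y x' ^ 2))
    with ((f x - f x' - dot (v x') (x - x')%C) - dot (v x' - v x)%C (y - x)%C
          + (K * pdist y x ^ 2 - K * pdist y x' ^ 2)).
  2:{ unfold dot; simpl. ring. }
  pose proof (dot_le (v x' - v x)%C (y - x)%C) as Hd. change (Cmod (y - x)%C) with (pdist y x) in Hd.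
  assert (Cmod (v x' - v x)%C * pdist y x <= 6 * (K * r) * (3 * r)).
  { apply Rmult_le_compat; auto. apply Cmod_ge_0. }
  apply Rabs_le_between in Hd. apply Rabs_le_between in Ht. apply Rabs_le_between. lra.
- replace (fst (v x) + 2 * K * (fst y - fst x) - (fst (v x') + 2 * K * (fst y - fst x')))
    with (fst (v x) + 2 * K * (fst x') - (fst (v x') + 2 * K * fst x)) by ring.
  apply HL; unfold Rminus; lra.
- replace (snd (v x) + 2 * K * (snd y - snd x) - (snd (v x') + 2 * K * (snd y - snd x')))
    with (snd (v x) + 2 * K * (snd x') - (snd (v x') + 2 * K * snd x)) by ring.
  apply HL; unfold Rminus; lra.
Qed.

(** Each net centre carries the patch of a nearest point of [E], and only patches of active centres
    are read. Weights in [[0, 1]] keep the blend nonnegative. *)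
Lemma whitney_extension : exists (C : R) (N : nat), 0 <= C /\ forall E : list (R * R),
  exists (A : R * R -> list (R * R))
         (F : R -> (R * R -> R) -> (R * R -> R * R) -> R * R -> jet),
  (forall y, incl (A y) E /\ (length (A y) <= N)%nat) /\
  (forall K f v, is_jet (F K f v)) /\
  (forall K f v f' v' y, (forall x, In x (A y) -> f x = f' x /\ v x = v' x) -> F K f v y = F K f' v' y) /\
  (forall K f v, 0 < K -> whitney_field K E f v ->
     (forall y, 0 <= j0 (F K f v y)) /\ (forall x, In x E -> j0 (F K f v x) = f x) /\
     (forall y, jbound 1 (C * K) (F K f v y))).
Proof.
destruct net_bounded_overlap as [N HN]. destruct cutoff_exists as (b & Hb & Hcut).
exists (600 * (1 + 8 * b) ^ N + 36), N.
assert (Hpow1 : 1 <= (1 + 8 * b) ^ N) by (apply pow_R1_Rle; lra).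
split; [lra|]. intros E.
destruct (pair_scale E) as (s & Hlip & (m & Hm & Hsm) & Hs1 & Hcap & Hpair).
assert (Hpos : forall x, 0 < s x) by (intros x; specialize (Hsm x); lra).
destruct (grid_exists E (m / 32) ltac:(lra)) as (L & HEL & HLE & HLc).
destruct (net_exists s L Hlip Hpos) as (Z & HZL & HZnd & HZc & HZs).
pose proof (HN s Z Hlip Hpos HZnd HZs) as HZN.
destruct (Hcut s Hlip Hpos) as (Phi & HPj & HP01 & HP1 & HP0 & HPc).
assert (Hnear : forall z, exists x, E <> nil -> In x E /\ forall y, In y E -> pdist z x <= pdist z y).
{ intros z. destruct E as [|a E']. exists z; congruence.
  destruct (argmin_exists (a :: E') (pdist z)) as (x & Hx). discriminate. exists x. auto. }
destruct (choice_fun _ Hnear) as [n Hn]. clear Hnear.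
assert (HnZ : forall z, In z Z -> In (n z) E /\ forall y, In y E -> pdist z (n z) <= pdist z y).
{ intros z Hz. apply Hn. destruct (HLE z (HZL z Hz)) as (a & Ha & _). intros ->. destruct Ha. }
exists (fun y => map n (filter (active s y) Z)),
  (fun K f v y => blendj (fun z => Phi z y) (fun z => patch K (f (n z)) (v (n z)) (n z) y) Z).
split; [|split; [|split]].
- intros y. split.
  + intros x Hx. apply in_map_iff in Hx. destruct Hx as (z & <- & Hz). apply filter_In in Hz.
    now apply HnZ.
  + rewrite length_map. apply HZN.
- intros K f v. apply (is_jet_blend Phi (fun z => patch K (f (n z)) (v (n z)) (n z))); auto.
  intros z. apply is_jet_patch.
- intros K f v f' v' y H. apply (blendj_ext _ _ _ (active s y)).
  + intros z _ Hz. now apply HP0.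
  + intros z Hz Ha. destruct (H (n z)) as [-> ->]; auto.
    apply in_map_iff. exists z. split; auto. apply filter_In. auto.
- intros K f v HK HW.
  assert (Hcore : forall y z, pdist y z <= s z / 16 -> active s y z = true).
  { intros y z H. apply activeP. specialize (Hpos z). lra. }
  split; [|split].
  + intros y. apply blendj_pos; [intros; apply HP01|]. intros z Hz.
    destruct (HW (n z) (proj1 (HnZ z Hz))) as (_ & H & _). now apply patch_pos.
  + intros x Hx. destruct (HZc x (HEL x Hx)) as (z0 & Hz0 & Hd0).
    assert (Hd1 : pdist x z0 <= s z0 / 16) by (specialize (Hpos z0); lra).
    apply (blendj_val _ _ (active s x) Z z0); auto.
    intros z Hz Ha. apply activeP in Ha. destruct (HnZ z Hz) as [H1 H2].
    (* [x] and [n z] both lie within [s z / 4] of [z]; two distinct points of [E] that close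
       contradict the pair scale. So every active patch is centred at [x]. *)
    assert (Enx : n z = x).
    { destruct (excluded_middle_informative (n z = x)) as [|Hne]; auto. exfalso.
      pose proof (Hpair z (n z) x H1 Hx Hne) as Hp. specialize (H2 x Hx).
      rewrite (pdist_sym x z) in Ha. specialize (Hpos z). unfold Rmax in Hp. destruct Rle_dec; lra. }
    rewrite Enx. simpl. replace (x - x)%C with (RtoC 0) by cring. rewrite Cmod_0. unfold dot; simpl. ring.
  + intros y. set (P := fun z => patch K (f (n z)) (v (n z)) (n z) y).
    set (G := blendj (fun z => Phi z y) P Z).
    assert (Hr0 : 0 < s y) by auto. specialize (Hs1 y) as Hr1.
    assert (Hpatch : forall z, In z Z -> active s y z = true ->
       Rabs (j0 (P z)) <= 36 * K /\ Rabs (jx (P z)) <= 12 * K /\ Rabs (jy (P z)) <= 12 * K).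
    { intros z Hz Ha. apply activeP in Ha. destruct (HnZ z Hz) as [H1 H2].
      destruct (HW (n z) H1) as (W1 & W2 & _). apply patch_bound; auto.
      - apply Rsqr_incr_0_var; [|lra]. rewrite !Rsqr_pow2.
        assert (K * f (n z) <= K * K) by (apply Rmult_le_compat_l; lra). lra.
      - destruct (HLE z (HZL z Hz)) as (a & HaE & Hda). specialize (H2 a HaE).
        pose proof (pdist_tri z y (n z)). pose proof (Hs1 z). lra. }
    assert (Hfin : forall Q, (forall z, In z Z -> active s y z = true -> jbound (s y) (600 * K) (jsub (P z) Q)) ->
      (Q = jzero \/ exists z, In z Z /\ active s y z = true /\ Phi z y = jone) ->
      jbound 1 (36 * K) Q -> jbound 1 ((600 * (1 + 8 * b) ^ N + 36) * K) G).
    { intros Q HQ1 HQ2 HQ3.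
      assert (HB : jbound (s y) (600 * K * (1 + 8 * b) ^ length (filter (active s y) Z)) (jsub G Q)).
      { apply blendj_bound; auto; lra. }
      assert (Hle : (1 + 8 * b) ^ length (filter (active s y) Z) <= (1 + 8 * b) ^ N).
      { apply Rle_pow; [lra|apply HZN]. }
      apply (Rmult_le_compat_l (600 * K)) in Hle; [|lra].
      apply (jbound_mono _ _ _ _ (Rlt_le _ _ Hr0) Hle) in HB.
      assert (HB1 : jbound 1 (600 * K * (1 + 8 * b) ^ N) (jsub G Q)).
      { set (B := 600 * K * (1 + 8 * b) ^ N) in *.
        assert (HB0 : 0 <= B) by (unfold B; apply Rmult_le_pos; lra).
        assert (B * s y <= B * 1) by (apply Rmult_le_compat_l; lra).
        assert (B * s y ^ 2 <= B * 1) by (apply Rmult_le_compat_l; nra).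
        destruct HB as (B1 & B2 & B3 & B4 & B5 & B6). repeat split; lra. }
      pose proof (jbound_add _ _ _ _ _ HB1 HQ3) as HA.
      replace (jadd (jsub G Q) Q) with G in HA.
      - eapply jbound_mono; [lra| |exact HA]. lra.
      - destruct G, Q. unfold jadd, jsub; simpl; f_equal; ring. }
    destruct (Rle_dec (1 / 4) (s y)) as [Hbig|Hsmall].
    (* Away from [E] or its clusters the scale is bounded below and 0 serves as comparison jet; the
       constant 600 comes from [36 * 16 <= 600]. *)
    * apply (Hfin jzero); auto; [|apply jbound_zero; lra].
      intros z Hz Ha. destruct (Hpatch z Hz Ha) as (P1 & P2 & P3).
      assert (600 * K * (1 / 16) <= 600 * K * s y ^ 2) by (apply Rmult_le_compat_l; nra).
      assert (600 * K * (1 / 4) <= 600 * K * s y) by (apply Rmult_le_compat_l; lra).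
      repeat split; unfold jsub, jzero; cbn [j0 jx jy jxx jxy jyy]; rewrite Rminus_0_r; try lra;
        unfold P; simpl; rewrite ?Rabs_R0, ?(Rabs_right (2 * K)) by lra; lra.
    * apply Rnot_le_lt in Hsmall.
      (* Here [s y] and [s z] are below 1, so the cap is not attained and [E] has points at a
         distance of order [s y]. *)
      assert (Hclose : forall z, In z Z -> active s y z = true -> pdist y (n z) <= 3 * s y).
      { intros z Hz Ha. apply activeP in Ha. destruct (active_scale s y z Hlip Ha) as [S1 S2].
        destruct (Hcap z) as [E1|(a & HaE & Hda)]; [lra|].
        pose proof (proj2 (HnZ z Hz) a HaE). pose proof (pdist_tri z y (n z)). lra. }
      destruct (Hcap y) as [E1|(a & HaE & Hda)]; [lra|].
      (* Mesh [m / 32] plus covering radius [s z0 / 32] is at most [s z0 / 16], where the cutoff is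
         identically 1. *)
      destruct (HLc y a HaE ltac:(lra)) as (p & Hp & Hdp).
      destruct (HZc p Hp) as (z0 & Hz0 & Hd0).
      assert (Hz1 : pdist y z0 <= s z0 / 16).
      { pose proof (pdist_tri p y z0). specialize (Hsm z0). lra. }
      pose proof (Hcore y z0 Hz1) as Ha0.
      apply (Hfin (P z0)).
      -- intros z Hz Ha. apply (jbound_mono _ (100 * K)); [lra|lra|].
         apply (patch_diff K f v E); auto; try apply HnZ; auto. lra.
      -- right. exists z0. auto.
      -- destruct (Hpatch z0 Hz0 Ha0) as (P1 & P2 & P3).
         repeat split; try lra; unfold P; simpl; rewrite ?Rabs_R0, ?(Rabs_right (2 * K)) by lra; lra.
Qed.

(** * From jets back to the norm, and the extension map *)

Lemma C2_norm_le_jet F B : is_jet F -> 0 <= B -> (forall y, jbound 1 B (F y)) ->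
  C2_norm_le (fun q => j0 (F q)) (3 * B).
Proof.
intros HF HB Hb y. unfold jet_norm.
replace (fold_right _ 0 mindices2)
  with (j0 (F y) ^ 2 + (jx (F y) ^ 2 + (jy (F y) ^ 2 + (jxx (F y) ^ 2 + (jxy (F y) ^ 2 + (jyy (F y) ^ 2 + 0)))))).
2:{ cbn [fold_right mindices2]. rewrite !(partial_is_jet F) by (auto; simpl; tauto). reflexivity. }
(* Six entries of size at most [B] give [sqrt 6 * B <= 3 * B]. *)
rewrite <- (sqrt_pow2 (3 * B)) by lra. apply sqrt_le_1_alt.
destruct (Hb y) as (H1 & H2 & H3 & H4 & H5 & H6).
assert (Hsq : forall a, Rabs a <= B -> a ^ 2 <= B ^ 2).
{ intros a Ha. apply pow_maj_Rabs. exact Ha. }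
rewrite pow1, Rmult_1_r in *.
pose proof (Hsq _ H1). pose proof (Hsq _ H2). pose proof (Hsq _ H3).
pose proof (Hsq _ H4). pose proof (Hsq _ H5). pose proof (Hsq _ H6). nra.
Qed.

Lemma C2_norm_le_zero B : 0 <= B -> C2_norm_le (fun _ => 0) B.
Proof.
intros HB y. apply Rle_trans with (3 * 0); [|lra].
refine (C2_norm_le_jet (fun _ => jzero) 0 is_jet_zero (Rle_refl 0) _ y).
intros _. apply jbound_zero; lra.
Qed.

Lemma trace_norm_0 E f : in_C2_plus_E E f -> trace_norm_le E f 0 -> forall x, In x E -> f x = 0.
Proof.
intros Hf Ht x Hx. specialize (Hf x Hx). destruct Hf as [Hf|Hf]; auto. exfalso.
destruct (Ht (f x / 2) ltac:(lra)) as (F & _ & HF & HFE & HN).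
pose proof (partial_le F _ (0, 0)%nat x HN ltac:(simpl; tauto)) as H.
change (partial (0, 0)%nat F x) with (F x) in H. rewrite (HFE x Hx), Rabs_right in H by lra. lra.
Qed.

(** Fixing the values off [E] makes equality on [E] an equality of functions, so that the extension
    is well defined on functions on [E]. *)
Definition restrict (E : list (R * R)) (f : R * R -> R) : R * R -> R :=
  fun x => if excluded_middle_informative (In x E) then f x else 0.

Lemma restrict_in E f x : In x E -> restrict E f x = f x.
Proof. intros H. unfold restrict. destruct excluded_middle_informative; tauto. Qed.

Lemma restrict_eq E f g : (forall x, In x E -> f x = g x) -> restrict E f = restrict E g.
Proof.
intros H. apply functional_extensionality. intros x. unfold restrict.
destruct excluded_middle_informative; auto.
Qed.

Lemma trace_norm_restrict E f M : trace_norm_le E f M -> trace_norm_le E (restrict E f) M.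
Proof.
intros H eps He. destruct (H eps He) as (F & H1 & H2 & H3 & H4).
exists F. repeat split; auto; try apply H1. intros x Hx. rewrite restrict_in; auto.
Qed.

Theorem theorem1 :
  exists (C : R) (D : nat),
  forall E : list (R * R),
  exists Ext : (R * R -> R) -> R -> (R * R -> R),
    (* Ext is a map C^2_+(E) x [0,oo) -> C^2_+(R^2) *)
    (forall f M, in_C2_plus_E E f -> 0 <= M -> in_C2_plus (Ext f M)) /\
    (forall f g M, (forall x, In x E -> f x = g x) -> Ext f M = Ext g M) /\
    (* (A) *)
    (forall M f, 0 <= M -> in_C2_plus_E E f -> trace_norm_le E f M ->
       (forall x, In x E -> Ext f M x = f x) /\ C2_norm_le (Ext f M) (C * M)) /\
    (* (B) *)
    (forall x : R * R, exists S : list (R * R),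
       incl S E /\ (length S <= D)%nat /\
       forall M f g, 0 <= M -> in_C2_plus_E E f -> in_C2_plus_E E g ->
         trace_norm_le E f M -> trace_norm_le E g M ->
         (forall y, In y S -> f y = g y) ->
         forall alpha, In alpha mindices2 ->
           partial alpha (Ext f M) x = partial alpha (Ext g M) x).
Proof.
destruct gradient_selection as (C1 & N1 & HC1 & Hsel).
destruct whitney_extension as (C2 & N2 & HC2 & Hext).
exists (3 * (C2 * (C1 * 16))), (N2 * N1)%nat. intros E.
destruct (Hsel E) as (S & v & HS & Hvext & Hv). destruct (Hext E) as (A & F & HA & HFj & HFext & HF).
clear Hsel Hext.
(* The construction needs [M > 0], so that [eps = M] yields an interpolant of norm at most [2 * M].
   Otherwise [Ext] is 0, which is correct for [M = 0], as [f] then vanishes on [E]. *)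
set (good := fun f M => 0 < M /\ trace_norm_le E (restrict E f) M).
set (J := fun f M => F (C1 * (16 * M)) (restrict E f) (v (16 * M) (restrict E f))).
set (Ext := fun f M => if excluded_middle_informative (good f M)
                       then (fun y => j0 (J f M y)) else (fun _ => 0)).
assert (HJ : forall f M, good f M -> (forall y, 0 <= j0 (J f M y)) /\
  (forall x, In x E -> j0 (J f M x) = f x) /\ C2_norm_le (fun y => j0 (J f M y)) (3 * (C2 * (C1 * 16)) * M)).
{ intros f M [HM Ht].
  destruct (Ht M HM) as (G & [HG _] & HGpos & HGE & HGN).
  (* [8 * (M + M)] is the [16 * M] of [J]; it depends on [M] alone, so [pick] uses the same constant
     for [f] and [g]. *)
  destruct (tame_of_C2 G (M + M) ltac:(lra) HG HGpos HGN) as [V HV].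
  assert (Htr : tame_trace (16 * M) E (restrict E f) G V).
  { split; auto. replace (16 * M) with (8 * (M + M)) by ring. exact HV. }
  pose proof (Hv (16 * M) (restrict E f) G V ltac:(lra) Htr) as HW.
  assert (HK : 0 < C1 * (16 * M)) by (apply Rmult_lt_0_compat; lra).
  destruct (HF _ _ _ HK HW) as (F1 & F2 & F3). split; [exact F1|]. split.
  - intros x Hx. rewrite <- (restrict_in E f x Hx). now apply F2.
  - replace (3 * (C2 * (C1 * 16)) * M) with (3 * (C2 * (C1 * (16 * M)))) by ring.
    apply C2_norm_le_jet; [apply HFj| |exact F3]. apply Rmult_le_pos; lra. }
assert (HE0 : forall f M, in_C2_plus_E E f -> 0 <= M -> trace_norm_le E f M -> ~ good f M -> M = 0).
{ intros f M Hf HM Ht Hn. destruct HM as [HM|]; auto. destruct Hn. split; auto.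
  now apply trace_norm_restrict. }
exists Ext. split; [|split; [|split]].
- intros f M Hf HM. unfold Ext. destruct excluded_middle_informative as [Hg|Hg].
  + destruct (HJ f M Hg) as (H1 & H2 & H3). split; [split|]; auto.
    * apply is_C2_is_jet. apply HFj.
    * eexists; exact H3.
  + split; [split|].
    * apply (is_C2_is_jet (fun _ => jzero) is_jet_zero).
    * exists 0. apply C2_norm_le_zero. lra.
    * intros; lra.
- intros f g M H. unfold Ext, good, J. now rewrite (restrict_eq E f g H).
- intros M f HM Hf Ht. unfold Ext. destruct excluded_middle_informative as [Hg|Hg].
  + destruct (HJ f M Hg) as (H1 & H2 & H3). auto.
  + pose proof (HE0 f M Hf HM Ht Hg) as ->. split.
    * intros x Hx. symmetry. now apply (trace_norm_0 E).
    * apply C2_norm_le_zero. lra.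
(* The jet at [x] reads the values and gradients at the points of [A x], and each of these gradients
   reads [f] on its own list. *)
- intros x. exists (flat_map S (A x)). split; [|split].
  + intros y Hy. apply in_flat_map in Hy. destruct Hy as (z & Hz & Hy).
    apply (HS z); auto. now apply (proj1 (HA x)).
  + eapply Nat.le_trans; [apply (length_flat_map_le S (A x) N1)|].
    * intros z Hz. apply HS. now apply (proj1 (HA x)).
    * apply Nat.mul_le_mono_r. apply HA.
  + intros M f g HM Hf Hg Htf Htg Hfg alpha Ha. unfold Ext.
    destruct excluded_middle_informative as [Gf|Gf];
    destruct excluded_middle_informative as [Gg|Gg]; auto.
    * rewrite !(partial_is_jet (J _ M)) by (auto; apply HFj). f_equal.
      assert (Hr : forall z y, In z (A x) -> In y (S z) -> restrict E f y = restrict E g y).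
      { intros z y Hz Hy. unfold restrict. destruct excluded_middle_informative; auto.
        apply Hfg. apply in_flat_map. eauto. }
      apply HFext. intros z Hz. split.
      -- apply (Hr z z Hz). apply HS. now apply (proj1 (HA x)).
      -- apply Hvext. intros y Hy. now apply (Hr z).
    (* One function being good gives [M > 0], the other not being good forces [M = 0]. *)
    * exfalso. pose proof (HE0 g M Hg HM Htg Gg). destruct Gf. lra.
    * exfalso. pose proof (HE0 f M Hf HM Htf Gf). destruct Gg. lra.
Qed.
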